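(* Let $w$ be a nonnegative integer. For $(P,Q)\in\check{\mathfrak R}(w)$ put $\check\Phi_w(P,Q)=(R(P),\check\varphi(P,Q))$. Then $\check\Phi_w$ is a bijection from $\check{\mathfrak R}(w)$ to $\hat{\mathfrak R}(w)$ such that, for every $(P,Q)\in\check{\mathfrak R}(w)$ with $(\hat P,\hat Q)=\check\Phi_w(P,Q)$, $$\mu(P)=\mu(\hat P),\qquad \nu(Q)=\nu(\hat Q),\qquad \varepsilon(P)-1=\varepsilon(\hat P),\qquad \delta(Q)+1=\delta(\hat Q).$$ Moreover, the inverse of $\check\Phi_w$ is given by $\check\Phi_w^{-1}(P,Q)=(\hat\varphi(P,Q),F(Q))$ for $(P,Q)\in\hat{\mathfrak R}(w)$.
   Context: Young diagrams. A Young diagram $\lambda=(\lambda_1\ge\lambda_2\ge\cdots)$ is identified with its finite set of boxes $(i,j)$, $1\le j\le\lambda_i$ (row $i$, column $j$, rows numbered from top to bottom). Set-valued tableaux. A set-valued column-strict tableau $P$ of shape $\lambda$ assigns to each box a nonempty finite set $P_{i,j}$ of positive integers such that $\max P_{i,j}<\min P_{i',j}$ for $i<i'$ and $\max P_{i,j}\le\min P_{i,j'}$ for $j<j'$ (whenever both boxes are in $\lambda$). The set of these is $\mathcal P_\lambda$. Put $\varepsilon(P)=\sum_{(i,j)\in\lambda}(|P_{i,j}|-1)$ and $\mu(P)=(\mu_1,\mu_2,\ldots)$ with $\mu_k=|\{(i,j)\in\lambda: k\in P_{i,j}\}|$. Let $\mathcal P^+_\lambda=\{P\in\mathcal P_\lambda:\varepsilon(P)>0\}$.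 For $P\in\mathcal P_\lambda^+$ let $r_1(P)=\max\{i:|P_{i,j}|>1\text{ for some }j\}$ and $r_1'(P)=\max\{j:|P_{r_1(P),j}|>1\}$; if $\varepsilon(P)=0$ put $r_1(P)=0$. All boxes strictly below row $r_1(P)$ contain a single integer, so the rows below row $r_1(P)$ are treated as an integer-valued column-strict tableau. Row insertion. Inserting an integer $x$ into a weakly increasing row: if some entry is $>x$, replace the leftmost entry $>x$ by $x$, and the replaced entry is bumped out; otherwise append $x$ in a new box at the end of the row and nothing is bumped out. Row insertion starting from row $i$: insert $x$ into row $i$, insert the bumped-out integer into row $i+1$, and so on, until a new box is added. The map $R$. For $P\in\mathcal P^+_\lambda$ let $x=\max P_{r_1(P),r_1'(P)}$; remove $x$ from box $(r_1(P),r_1'(P))$ and insert $x$ by row insertion starting from row $r_1(P)+1$. The resulting set-valued column-strict tableau is $R(P)$, and $(r_2(P),r_2'(P))$ is the new box. Reverse plane partitions. A reverse plane partition $Q$ of $\lambda$ assigns to each box of $\lambda$ a positive integer $Q_{i,j}$, weakly increasing along rows (left to right) and weakly increasing down columns. The set of these is $\mathcal Q_\lambda$. Put $\delta(Q)=|\{(i,j)\in\lambda: (i+1,j)\in\lambda,\ Q_{i,j}=Q_{i+1,j}\}|$ and $\nu(Q)=(\nu_1,\nu_2,\ldots)$, where $\nu_k$ is the number of columns of $Q$ containing $k$. Let $\mathcal Q_\lambda^+=\{Q\in\mathcal Q_\lambda:\delta(Q)>0\}$. For $Q\in\mathcal Q_\lambda^+$ let $f_1(Q)=\max\{i: Q_{i,j}=Q_{i+1,j}\text{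 for some }j\}$ and $f_1'(Q)=\max\{j:Q_{f_1(Q),j}=Q_{f_1(Q)+1,j}\}$ (only boxes of $\lambda$ are compared); if $\delta(Q)=0$ put $f_1(Q)=0$. Jeu de taquin. A null box at $(i,j)$ of a tableau $T$ is slid as follows: if there is no box $(i+1,j)$, or $T_{i+1,j}>T_{i,j+1}$, swap it with box $(i,j+1)$; if there is no box $(i,j+1)$, or $T_{i+1,j}\le T_{i,j+1}$, swap it with box $(i+1,j)$. Repeat until the null box is at a corner (neither $(i+1,j)$ nor $(i,j+1)$ is a box), then remove it. The map $F$. For $Q\in\mathcal Q^+_\lambda$ make the box $(f_1(Q),f_1'(Q))$ null (erasing its entry) and apply the jeu de taquin. The resulting reverse plane partition is $F(Q)$, and $(f_2(Q),f_2'(Q))$ is the removed box (a corner of $\lambda$). The sets. $\mathfrak R_\lambda=\mathcal P_\lambda\times\mathcal Q_\lambda$ and $\mathfrak R^+_\lambda=\{(P,Q)\in\mathfrak R_\lambda:\varepsilon(P)+\delta(Q)>0\}$. $\check{\mathfrak R}_\lambda$ is the set of $(P,Q)\in\mathfrak R_\lambda^+$ such that $r_1(P)>f_1(Q)$, or $r_1(P)=f_1(Q)$ and $r_2(P)\le f_2(Q)$. $\hat{\mathfrak R}_\lambda$ is the set of $(P,Q)\in\mathfrak R_\lambda^+$ such that $r_1(P)<f_1(Q)$, or $r_1(P)=f_1(Q)$ and $r_2(P)>f_2(Q)$. $\check{\mathfrak R}(w)=\bigcup_{\lambda:\lambda_1=w}\check{\mathfrak R}_\lambda$ and $\hat{\mathfrak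 R}(w)=\bigcup_{\lambda:\lambda_1=w}\hat{\mathfrak R}_\lambda$, over Young diagrams $\lambda$ with $\lambda_1=w$. The map $\check\varphi$. For $(P,Q)\in\check{\mathfrak R}_\lambda$: add to $Q$ a null box at $(r_2(P),r_2'(P))$. While the null box $(i,j)$ is in a row $i>r_1(P)$, move it by reverse sliding: if $j>1$ and the entry at $(i-1,j)$ is $<$ the entry at $(i,j-1)$, swap it with box $(i,j-1)$; otherwise (if $j=1$ or the entry at $(i-1,j)$ is $\ge$ the entry at $(i,j-1)$) swap it with box $(i-1,j)$. Stop as soon as the null box is in row $r_1(P)$; let $(r_3,r_3')$ be its position. Put the original entry $Q_{r_3,r_3'}$ into it. The result is $\check\varphi(P,Q)$, a reverse plane partition of $\lambda\cup\{(r_2(P),r_2'(P))\}$. The map $\hat\varphi$. For $(P,Q)\in\hat{\mathfrak R}_\lambda$: let $x$ be the unique integer in $P_{f_2(Q),f_2'(Q)}$; remove the box $(f_2(Q),f_2'(Q))$ from $P$. Insert $x$ by reverse row insertion successively into rows $f_2(Q)-1, f_2(Q)-2,\ldots,f_1(Q)+1$: inserting $z$ into a row by reverse bumping replaces the rightmost entry $<z$ by $z$, and the replaced entry is inserted into the row above. Let $y$ be the integer bumped out of row $f_1(Q)+1$ (if $f_2(Q)=f_1(Q)+1$, then $y=x$), and let $P^{(3)}$ be the tableau obtained. Find $j$ such that every element of $P^{(3)}_{f_1(Q),j'}$ with $j'\le j$ is $<y$ and every element of $P^{(3)}_{f_1(Q),j''}$ with $j''>j$ is $\ge y$. Add $y$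 to the set in box $(f_1(Q),j)$. The result is $\hat\varphi(P,Q)$. *)

(* Defs.v *)
From mathcomp Require Import all_boot finmap.
From mathcomp Require Import classical_sets functions.

Set Implicit Arguments.
Unset Strict Implicit.
Unset Printing Implicit Defensive.

Local Open Scope classical_set_scope.
Local Open Scope nat_scope.

(* Boxes are pairs (row, column), both numbered from 1.  A Young diagram is
   given by the sequence of its nonzero row lengths. *)
Definition is_part (lam : seq nat) : bool := sorted geq lam && (0 \notin lam).

Definition part (lam : seq nat) (i : nat) : nat := nth 0 lam i.-1.

Definition boxes (lam : seq nat) : pred (nat * nat) :=
  [pred b | (0 < b.1) && (0 < b.2 <= part lam b.1)].

(* A tableau is a finitely supported function on nat * nat whose support is
   the set of its boxes.  This loses nothing since the entries of a box are a
   nonempty set, resp. a positive integer; the value fset0, resp. 0, means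
   that there is no box, or (in the slides below) that the box is null. *)
Definition svtab := {fsfun nat * nat -> {fset nat} with fset0}.
Definition tab := {fsfun nat * nat -> nat with 0}.

Definition rowlen (B : {fset nat * nat}) (i : nat) : nat :=
  #|` [fset b in B | b.1 == i]%fset |.

(* The minimum and maximum of a nonempty set; on a singleton both are its
   unique element. *)
Definition fsmax (A : {fset nat}) : nat := \max_(k <- A) k.
Definition fsmin (A : {fset nat}) : nat := \big[minn/fsmax A]_(k <- A) k.

Definition calP (lam : seq nat) : set svtab := [set P : svtab |
  [/\ finsupp P =i boxes lam,
      forall (b : nat * nat) (k : nat), k \in P b -> 0 < k,
      forall i i' j, boxes lam (i, j) -> boxes lam (i', j) -> i < i' ->
        fsmax (P (i, j)) < fsmin (P (i', j))
    & forall i j j', boxes lam (i, j) -> boxes lam (i, j') -> j < j' ->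
        fsmax (P (i, j)) <= fsmin (P (i, j'))]].

Definition eps (P : svtab) : nat := \sum_(b <- finsupp P) (#|` P b| - 1).

Definition mu (P : svtab) (k : nat) : nat :=
  #|` [fset b in finsupp P | k \in P b]%fset |.

Definition r1 (P : svtab) : nat :=
  \max_(b <- finsupp P | 1 < #|` P b|) b.1.
Definition r1' (P : svtab) : nat :=
  \max_(b <- finsupp P | (b.1 == r1 P) && (1 < #|` P b|)) b.2.

(* Row insertion of x starting from row i; it returns the new tableau and the
   new box.  The column j is that of the leftmost entry > x, or the first one
   past the end of the row.  The argument n bounds the number of bumps. *)
Fixpoint row_insert (n : nat) (P : svtab) (i x : nat) : svtab * (nat * nat) :=
  let l := rowlen (finsupp P) i in
  let j := (find (fun j => x < fsmax (P (i, j))) (iota 1 l)).+1 in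
  let P' := [fsfun P with (i, j) |-> [fset x]%fset] in
  if n is n'.+1 then
    if j <= l then row_insert n' P' i.+1 (fsmax (P (i, j))) else (P', (i, j))
  else (P', (i, j)).

(* Each bump happens in a different nonempty row, so #|` finsupp P| bumps
   are enough. *)
Definition R_full (P : svtab) : svtab * (nat * nat) :=
  let b := (r1 P, r1' P) in
  let x := fsmax (P b) in
  row_insert #|` finsupp P|
    [fsfun P with b |-> (P b `\ x)%fset] (r1 P).+1 x.

Definition Rmap (P : svtab) : svtab := (R_full P).1.
Definition r2 (P : svtab) : nat := (R_full P).2.1.
Definition r2' (P : svtab) : nat := (R_full P).2.2.

Definition calQ (lam : seq nat) : set tab := [set Q : tab |
  [/\ finsupp Q =i boxes lam,
      forall i j j', boxes lam (i, j) -> boxes lam (i, j') -> j < j' ->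
        Q (i, j) <= Q (i, j')
    & forall i i' j, boxes lam (i, j) -> boxes lam (i', j) -> i < i' ->
        Q (i, j) <= Q (i', j)]].

Definition eq_below (Q : tab) (b : nat * nat) : bool :=
  ((b.1.+1, b.2) \in finsupp Q) && (Q b == Q (b.1.+1, b.2)).

Definition delta (Q : tab) : nat :=
  #|` [fset b in finsupp Q | eq_below Q b]%fset |.

Definition nu (Q : tab) (k : nat) : nat :=
  #|` [fset b.2 | b in finsupp Q & Q b == k]%fset |.

Definition f1 (Q : tab) : nat := \max_(b <- finsupp Q | eq_below Q b) b.1.
Definition f1' (Q : tab) : nat :=
  \max_(b <- finsupp Q | (b.1 == f1 Q) && eq_below Q b) b.2.

Definition move_null (T : tab) (b c : nat * nat) : tab * (nat * nat) :=
  ([fsfun [fsfun T with b |-> T c] with c |-> 0], c).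

(* One jeu de taquin slide of the null box s.2 of s.1; nothing happens once
   it is at a corner, where it is no longer in the support of s.1. *)
Definition slide (s : tab * (nat * nat)) : tab * (nat * nat) :=
  let: (T, (i, j)) := s in
  let down := (i.+1, j) in
  let right := (i, j.+1) in
  if (down \notin finsupp T) && (right \notin finsupp T) then s
  else if (down \notin finsupp T) ||
          ((right \in finsupp T) && (T right < T down))
  then move_null T (i, j) right
  else move_null T (i, j) down.

(* The null box visits distinct boxes, so it reaches a corner within
   #|` finsupp Q| slides. *)
Definition F_full (Q : tab) : tab * (nat * nat) :=
  let b := (f1 Q, f1' Q) in
  iter #|` finsupp Q| slide ([fsfun Q with b |-> 0], b).

Definition Fmap (Q : tab) : tab := (F_full Q).1.
Definition f2 (Q : tab) : nat := (F_full Q).2.1.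
Definition f2' (Q : tab) : nat := (F_full Q).2.2.

Definition calR (lam : seq nat) : set (svtab * tab) := calP lam `*` calQ lam.

Definition calR_plus (lam : seq nat) : set (svtab * tab) :=
  [set PQ : svtab * tab | calR lam PQ /\ 0 < eps PQ.1 + delta PQ.2].

Definition calR_check (lam : seq nat) : set (svtab * tab) :=
  [set PQ : svtab * tab | calR_plus lam PQ /\
    (f1 PQ.2 < r1 PQ.1 \/ r1 PQ.1 = f1 PQ.2 /\ r2 PQ.1 <= f2 PQ.2)].

Definition calR_hat (lam : seq nat) : set (svtab * tab) :=
  [set PQ : svtab * tab | calR_plus lam PQ /\
    (r1 PQ.1 < f1 PQ.2 \/ r1 PQ.1 = f1 PQ.2 /\ f2 PQ.2 < r2 PQ.1)].

Definition calR_check_width (w : nat) : set (svtab * tab) :=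
  \bigcup_(lam in [set lam | is_part lam /\ part lam 1 = w]) calR_check lam.

Definition calR_hat_width (w : nat) : set (svtab * tab) :=
  \bigcup_(lam in [set lam | is_part lam /\ part lam 1 = w]) calR_hat lam.

(* One reverse slide of the null box s.2, which stops in row r. *)
Definition reverse_slide (r : nat) (s : tab * (nat * nat)) :
    tab * (nat * nat) :=
  let: (T, (i, j)) := s in
  if i <= r then s
  else if (1 < j) && (T (i.-1, j) < T (i, j.-1))
  then move_null T (i, j) (i, j.-1)
  else move_null T (i, j) (i.-1, j).

(* Each reverse slide decreases the sum of the coordinates of the null box,
   so r2 P + r2' P of them are enough. *)
Definition check_phi (P : svtab) (Q : tab) : tab :=
  let: (T, b3) :=
    iter (r2 P + r2' P) (reverse_slide (r1 P)) (Q, (r2 P, r2' P)) in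
  [fsfun T with b3 |-> Q b3].

(* Reverse row insertion of z successively into the n rows i, i - 1, ...;
   it returns the tableau and the integer bumped out of the last row. *)
Fixpoint reverse_insert (n : nat) (P : svtab) (i z : nat) : svtab * nat :=
  if n is n'.+1 then
    let j := \max_(j <- iota 1 (rowlen (finsupp P) i)
                     | fsmax (P (i, j)) < z) j in
    reverse_insert n' [fsfun P with (i, j) |-> [fset z]%fset] i.-1
      (fsmax (P (i, j)))
  else (P, z).

Definition hat_phi (P : svtab) (Q : tab) : svtab :=
  let b := (f2 Q, f2' Q) in
  let i := f1 Q in
  let: (P3, y) :=
    reverse_insert ((f2 Q).-1 - i)
      [fsfun P with b |-> fset0] (f2 Q).-1 (fsmax (P b)) in
  let l := rowlen (finsupp P3) i in
  let splits_at j :=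
    all (fun j1 : nat => all (fun a => a < y) (P3 (i, j1))) (iota 1 j) &&
    all (fun j2 : nat => all (fun a => y <= a) (P3 (i, j2))) (iota j.+1 (l - j)) in
  let j := (find splits_at (iota 1 l)).+1 in
  [fsfun P3 with (i, j) |-> (y |` P3 (i, j))%fset].

Definition check_Phi (PQ : svtab * tab) : svtab * tab :=
  (Rmap PQ.1, check_phi PQ.1 PQ.2).

Definition hat_Phi (PQ : svtab * tab) : svtab * tab :=
  (hat_phi PQ.1 PQ.2, Fmap PQ.2).

(* Main.v *)
Require Import Defs.
From mathcomp Require Import all_boot finmap.
From mathcomp Require Import classical_sets functions.
From mathcomp Require Import zify.

(* Both maps are cut into invertible local moves.  For P the states are triples (P, i, v),
   where v is waiting to be inserted into row i: a bump and a reverse bump are mutually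
   inverse on these states.  For Q the states are tableaux with a null box, on which a slide
   and a reverse slide are mutually inverse as long as the columns are strict weakly to the
   right of the null box.  Hence R is undone by reverse insertion and the reverse slides by
   F; the only question is whether the results lie in the right set when r1(P) = f1(Q),
   that is, whether two successive insertion paths (resp. sliding paths) leaving the same
   row do not cross.  For insertions, the integers bumped by the second one are smaller, row
   by row, than those of the first.  For slides, let the first path go from row i to row
   i + 1 in column b(i): the inequality between its two candidates there bars the column
   b(i) to the second path.  Finally mu and nu are preserved by the local moves, and they
   determine epsilon and delta because epsilon(P) + |lambda| is the sum of mu(P) and
   |lambda| - delta(Q) is the sum of nu(Q). *)

Set Implicit Arguments.
Unset Strict Implicit.
Unset Printing Implicit Defensive.

Local Open Scope nat_scope.

(** * Null boxes and jeu de taquin *)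

(** Row r, where R and F begin, does not fit the local moves: two equal entries in rows r and r + 1
    destroy the strictness that reverse slides need, and row r of P may hold larger sets. These data
    are split off by [fill] and [attach]. As ties go down, F first moves the lower of the two equal
    entries up, so one may as well erase the lower one and start with the null box in row r + 1;
    likewise R is an insertion into row r + 1 after one integer has been detached from row r.
    Complete paths are inductive relations, free of iteration counts, because they have to be
    extended backwards at their start as well as followed forwards. The barrier columns b(i) occur
    in two versions. Read on the tableau before the path, they stop the reverse slides of
    [check_phi]; read on the tableau after it and shifted one column to the left, they drive the
    next path of F down at least to the row where the first one ended. *)

Definition diagram (D : {fset nat * nat}) : Prop :=
  (forall i j, (i, j) \in D -> 0 < i /\ 0 < j) /\
  (forall i j i' j', (i, j) \in D -> 0 < i' <= i -> 0 < j' <= j ->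
    (i', j') \in D).

(** The hook running down the first column and then along row i to (i, j) already has i + j - 1
    boxes. This bound makes all paths terminate and shows that the iteration counts in the
    definitions suffice. *)
Lemma diagram_card D i j : diagram D -> (i, j) \in D -> i + j <= #|` D|.+1.
Proof.
move=> [Dpos Dle] ijD; have [i0 j0] := Dpos _ _ ijD.
pose hook k := if k <= i then (k, 1) else (i, k.+1 - i).
have hook_inj : {in iota 1 (i + j).-1 &, injective hook}.
  move=> k k'; rewrite !mem_iota /hook => hk hk'.
  by case: ifP => h; case: ifP => h' [] *; lia.
have : size (map hook (iota 1 (i + j).-1)) <= size (enum_fset D).
  apply: uniq_leq_size; first by rewrite map_inj_in_uniq ?iota_uniq.
  move=> b /mapP[k]; rewrite mem_iota /hook => hk ->.
  by case: ifP => h; apply: (Dle _ _ _ _ ijD); lia.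
rewrite size_map size_iota; lia.
Qed.

(** Only the larger side has to be a box: the value 0, at the null box or outside the diagram, is
    harmless on the smaller side. *)
Definition monotone_tab (T : tab) : Prop := forall i j i' j',
  i <= i' -> j <= j' -> T (i', j') != 0 -> T (i, j) <= T (i', j').

(* Rows r and r.+1 may agree up to column c only, and the lower rows nowhere; this holds for
   r = f1 Q and c = f1' Q. *)
Definition strict_below (r c : nat) (T : tab) : Prop := forall i i' j,
  r <= i -> (r = i -> c < j) -> i < i' -> T (i', j) != 0 ->
  T (i, j) < T (i', j).

Definition validQ (D : {fset nat * nat}) (Q : tab) : Prop :=
  [/\ diagram D, forall b, (Q b != 0) = (b \in D) & monotone_tab Q].

(** The null box lies strictly below row r and strictly right of column c, so the entry above it
    already belongs to the region where columns are strict. *)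
Definition hole (D : {fset nat * nat}) (r c : nat) (T : tab) (i j : nat) :
    Prop :=
  [/\ diagram D, [&& (i, j) \in D, 0 < r < i & c < j],
      forall b, (T b != 0) = (b \in D) && (b != (i, j)),
      monotone_tab T & strict_below r c T].

Definition mv (T : tab) (b c : nat * nat) : tab := (move_null T b c).1.

Lemma mvE T b c x :
  mv T b c x = if x == c then 0 else if x == b then T c else T x.
Proof. by rewrite /mv /move_null /= !fsfun_withE. Qed.

Lemma move_nullE T b c : move_null T b c = (mv T b c, c).
Proof. by []. Qed.

Lemma hole0 D r c T i j : hole D r c T i j -> T (i, j) = 0.
Proof.
by case=> _ _ supp _ _; apply/eqP; rewrite -[_ == _]negbK supp eqxx andbF.
Qed.

Lemma hole_supp D r c T i j b : hole D r c T i j -> T b != 0 ->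
  b \in D /\ b <> (i, j).
Proof. by case=> _ _ supp _ _; rewrite supp => /andP[-> /eqP]. Qed.

Lemma hole_in D r c T i j b : hole D r c T i j -> b \in D -> b <> (i, j) ->
  T b != 0.
Proof. by case=> _ _ supp _ _ bD /eqP nb; rewrite supp bD. Qed.

Lemma pair_neq (i j i' j' : nat) : (i, j) <> (i', j') <-> i <> i' \/ j <> j'.
Proof.
split=> [h|[] h [] //]; case: (eqVneq i i') h => [-> h|/eqP]; last by left.
by right=> e; apply: h; rewrite e.
Qed.

Lemma mv_supp (D : {fset nat * nat}) (T : tab) i j i' j' :
  (forall b, (T b != 0) = (b \in D) && (b != (i, j))) ->
  (i, j) \in D -> (i', j') \in D -> (i, j) != (i', j') ->
  forall b, (mv T (i, j) (i', j') b != 0) = (b \in D) && (b != (i', j')).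
Proof.
move=> supp ij ij' ne b; rewrite mvE.
case: (eqVneq b (i', j')) => [->|nb']; first by rewrite andbF.
case: (eqVneq b (i, j)) => [->|nb]; first by rewrite supp ij ij' eq_sym ne.
by rewrite supp nb.
Qed.

Ltac case_box := 
  match goal with |- context [(?i, ?j) == (?i', ?j')] =>
    case: (@eqP _ (i, j) (i', j')) => [[? ?]|/pair_neq ?]; subst => //=
  end.

Lemma hole_right D r c T i j : hole D r c T i j -> T (i, j.+1) != 0 ->
  (T (i.+1, j) != 0 -> T (i, j.+1) < T (i.+1, j)) ->
  hole D r c (mv T (i, j) (i, j.+1)) i j.+1.
Proof.
move=> H Tr lt; have T0 := hole0 H; have [rD _] := hole_supp H Tr.
have Hin := hole_in H; have Hs := hole_supp H.
case: H => dD /and3P[ijD /andP[r0 ri] cj] supp mono strict.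
have [Dpos Dle] := dD; have [i0 j0] := Dpos _ _ ijD.
have below i2 : i < i2 -> T (i2, j) != 0 -> T (i, j.+1) < T (i2, j).
  move=> ii2 Ti2; have [i2D _] := Hs _ Ti2.
  have Tj : T (i.+1, j) != 0.
    by apply: Hin; [apply: (Dle _ _ _ _ i2D)|apply/pair_neq]; lia.
  by apply: (leq_trans (lt Tj)); apply: mono => //; lia.
split=> //.
- by rewrite rD r0 ri; lia.
- by apply: mv_supp => //; apply/eqP/pair_neq; lia.
- move=> i1 j1 i2 j2 ii jj; rewrite !mvE.
  repeat case_box; try lia; first by move=> ?; apply: mono; lia.
  - move=> Ti2; case: (ltnP j j2) => h; first by apply: mono.
    have ej : j = j2 by lia.
    by subst; apply/ltnW/below => //; lia.
  - exact: mono.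
- move=> i1 i2 j1 ri1 ci1 ii; rewrite !mvE.
  repeat case_box; try lia.
  (* Above its new place the moved entry inherits strictness from column j + 1; this is why columns
     must be strict to the right of the null box. *)
  - move=> Ti; apply: (@leq_ltn_trans (T (i1, j.+1))).
      by apply: mono; try lia; apply: Hin; [apply: (Dle _ _ _ _ rD)|apply/pair_neq]; lia.
    by apply: strict => //; lia.
  - by move=> ?; apply: below; lia.
  - exact: strict.
Qed.

Lemma hole_down D r c T i j : hole D r c T i j -> T (i.+1, j) != 0 ->
  (T (i, j.+1) != 0 -> T (i.+1, j) <= T (i, j.+1)) ->
  hole D r c (mv T (i, j) (i.+1, j)) i.+1 j.
Proof.
move=> H Tr lt; have T0 := hole0 H; have [rD _] := hole_supp H Tr.
have Hin := hole_in H; have Hs := hole_supp H.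
case: H => dD /and3P[ijD /andP[r0 ri] cj] supp mono strict.
have [Dpos Dle] := dD; have [i0 j0] := Dpos _ _ ijD.
have right i2 j2 : i <= i2 -> j < j2 -> T (i2, j2) != 0 ->
    T (i.+1, j) <= T (i2, j2).
  move=> ii2 jj2 Ti2; have [i2D _] := Hs _ Ti2.
  have Tj : T (i, j.+1) != 0.
    by apply: Hin; [apply: (Dle _ _ _ _ i2D)|apply/pair_neq]; lia.
  by apply: (leq_trans (lt Tj)); apply: mono => //; lia.
split=> //.
- by rewrite rD r0 cj; lia.
- by apply: mv_supp => //; apply/eqP/pair_neq; lia.
- move=> i1 j1 i2 j2 ii jj; rewrite !mvE.
  repeat case_box; try lia; first by move=> ?; apply: mono; lia.
  - move=> Ti2; case: (ltnP j j2) => h; first by apply: right.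
    have ej : j = j2 by lia.
    by subst; apply: mono => //; lia.
  - exact: mono.
- move=> i1 i2 j1 ri1 ci1 ii; rewrite !mvE.
  repeat case_box; try lia.
  - by move=> _; apply: strict => //; lia.
  - by move=> Ti2; apply: strict => //; lia.
  - exact: strict.
Qed.

Lemma hole_left D r c T i j : hole D r c T i j -> c < j.-1 ->
  T (i.-1, j) < T (i, j.-1) ->
  hole D r c (mv T (i, j) (i, j.-1)) i j.-1.
Proof.
move=> H cj1 lt; have T0 := hole0 H.
have Tl : T (i, j.-1) != 0 by lia.
have [lD _] := hole_supp H Tl.
have Hin := hole_in H; have Hs := hole_supp H.
case: H => dD /and3P[ijD /andP[r0 ri] cj] supp mono strict.
have [Dpos Dle] := dD; have [i0 j0] := Dpos _ _ ijD.
have above i2 : i2 < i -> T (i2, j) < T (i, j.-1).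
  move=> ii2; apply: leq_ltn_trans lt; apply: mono; try lia.
  by apply: Hin; [apply: (Dle _ _ _ _ ijD)|apply/pair_neq]; lia.
split=> //.
- by rewrite lD r0 ri.
- by apply: mv_supp => //; apply/eqP/pair_neq; lia.
- move=> i1 j1 i2 j2 ii jj; rewrite !mvE.
  repeat case_box; try lia.
  - move=> _; case: (ltnP j1 j) => h; first by apply: mono => //; lia.
    have ej : j1 = j by lia.
    by subst; apply/ltnW/above; lia.
  - by move=> Ti2; apply: mono => //; lia.
  - exact: mono.
- move=> i1 i2 j1 ri1 ci1 ii; rewrite !mvE.
  repeat case_box; try lia.
  - by move=> _; apply: above; lia.
  - move=> Ti2; apply: (@leq_trans (T (i2, j.-1))); last by apply: mono => //; lia.
    have [i2D _] := Hs _ Ti2; apply: strict => //; try lia.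
    by apply: Hin; [apply: (Dle _ _ _ _ i2D)|apply/pair_neq]; lia.
  - exact: strict.
Qed.

Lemma hole_up D r c T i j : hole D r c T i j -> r < i.-1 ->
  (T (i, j.-1) <= T (i.-1, j)) ->
  hole D r c (mv T (i, j) (i.-1, j)) i.-1 j.
Proof.
move=> H ri1 lt; have T0 := hole0 H.
have Hin := hole_in H; have Hs := hole_supp H.
case: H => dD /and3P[ijD /andP[r0 ri] cj] supp mono strict.
have [Dpos Dle] := dD; have [i0 j0] := Dpos _ _ ijD.
have uD : (i.-1, j) \in D by apply: (Dle _ _ _ _ ijD); lia.
have Tu : T (i.-1, j) != 0 by apply: Hin => //; apply/pair_neq; lia.
split=> //.
- by rewrite uD r0 ri1 cj.
- by apply: mv_supp => //; apply/eqP/pair_neq; lia.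
- move=> i1 j1 i2 j2 ii jj; rewrite !mvE.
  repeat case_box; try lia.
  - move=> _; case: (ltnP i1 i) => h; first by apply: mono => //; lia.
    have ei : i1 = i by lia.
    subst; apply: leq_trans lt; case: (ltnP j1 j.-1) => h1; last first.
      by have -> : j1 = j.-1 by lia.
    apply: mono => //; try lia.
    by apply: Hin; [apply: (Dle _ _ _ _ ijD)|apply/pair_neq]; lia.
  - by move=> Ti2; apply: mono => //; lia.
  - exact: mono.
- move=> i1 i2 j1 ri2 ci1 ii; rewrite !mvE.
  repeat case_box; try lia.
  - by move=> _; apply: strict => //; lia.
  - by move=> Ti2; apply: strict => //; lia.
  - exact: strict.
Qed.

(** * Complete sliding paths and their reversal *)

Inductive slides (D : {fset nat * nat}) (r c : nat) :
    tab -> nat -> nat -> tab -> nat -> nat -> Prop :=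
| slides_stop T i j : hole D r c T i j ->
    T (i.+1, j) = 0 -> T (i, j.+1) = 0 -> slides D r c T i j T i j
| slides_right T i j Q s t : hole D r c T i j -> T (i, j.+1) != 0 ->
    (T (i.+1, j) != 0 -> T (i, j.+1) < T (i.+1, j)) ->
    slides D r c (mv T (i, j) (i, j.+1)) i j.+1 Q s t ->
    slides D r c T i j Q s t
| slides_down T i j Q s t : hole D r c T i j -> T (i.+1, j) != 0 ->
    (T (i, j.+1) != 0 -> T (i.+1, j) <= T (i, j.+1)) ->
    slides D r c (mv T (i, j) (i.+1, j)) i.+1 j Q s t ->
    slides D r c T i j Q s t.

Lemma slides_exist D r c T i j : hole D r c T i j ->
  exists Q s t, slides D r c T i j Q s t.
Proof.
have [n] := ubnP (#|` D|.+1 - (i + j)).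
elim: n T i j => // n IH T i j le_n H.
have step i' j' : hole D r c (mv T (i, j) (i', j')) i' j' -> i + j < i' + j' ->
    exists Q s t, slides D r c (mv T (i, j) (i', j')) i' j' Q s t.
  move=> H' lt; apply: IH (H'); case: H' => dD /and3P[ijD _ _] _ _ _.
  by have := diagram_card dD ijD; lia.
case: (eqVneq (T (i.+1, j)) 0) => d; case: (eqVneq (T (i, j.+1)) 0) => e.
- by exists T, i, j; apply: slides_stop.
- have lt : T (i.+1, j) != 0 -> T (i, j.+1) < T (i.+1, j) by rewrite d.
  have [||Q [s [t S]]] := step i j.+1; [exact: hole_right|lia|].
  by exists Q, s, t; apply: slides_right.
- have lt : T (i, j.+1) != 0 -> T (i.+1, j) <= T (i, j.+1) by rewrite e.
  have [||Q [s [t S]]] := step i.+1 j; [exact: hole_down|lia|].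
  by exists Q, s, t; apply: slides_down.
- case: (ltnP (T (i, j.+1)) (T (i.+1, j))) => lt.
    have [||Q [s [t S]]] := step i j.+1; [exact: hole_right|lia|].
    by exists Q, s, t; apply: slides_right.
  have [||Q [s [t S]]] := step i.+1 j; [exact: hole_down|lia|].
  by exists Q, s, t; apply: slides_down.
Qed.

Lemma slides_start D r c T i j Q s t : slides D r c T i j Q s t ->
  hole D r c T i j.
Proof. by case. Qed.

Lemma slides_end D r c T i j Q s t : slides D r c T i j Q s t ->
  [/\ hole D r c Q s t, Q (s.+1, t) = 0 & Q (s, t.+1) = 0].
Proof. by elim. Qed.

Lemma slides_le D r c T i j Q s t : slides D r c T i j Q s t ->
  i <= s /\ j <= t.
Proof. by elim=> // *; lia. Qed.

Lemma slides_iter D r c T i j Q s t n : slides D r c T i j Q s t ->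
  s + t <= i + j + n -> iter n slide (T, (i, j)) = (Q, (s, t)).
Proof.
move=> S; elim: S n => {T i j Q s t} [T i j H d e|T i j Q s t H e lt S IH|
    T i j Q s t H d lt S IH] n le_n.
- by elim: n {le_n} => // n /= ->; rewrite /= !mem_finsupp d e.
- have [? ?] := slides_le S.
  case: n le_n => [|n] le_n; first lia.
  rewrite iterSr /= !mem_finsupp e /= andbF.
  case: (eqVneq (T (i.+1, j)) 0) lt => /= [_|d] lt; last rewrite lt //;
    by rewrite move_nullE; apply: IH; lia.
- have [? ?] := slides_le S.
  case: n le_n => [|n] le_n; first lia.
  rewrite iterSr /= !mem_finsupp d /=.
  case: (eqVneq (T (i, j.+1)) 0) lt => /= [_|e] lt; last rewrite ltnNge lt //=;
    by rewrite move_nullE; apply: IH; lia.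
Qed.

Lemma mv_out T i j i' j' k l : (k, l) <> (i, j) -> (k, l) <> (i', j') ->
  mv T (i, j) (i', j') (k, l) = T (k, l).
Proof. by move=> /eqP/negbTE h /eqP/negbTE h'; rewrite mvE h h'. Qed.

Lemma mv_new T i j i' j' : (i, j) <> (i', j') ->
  mv T (i, j) (i', j') (i, j) = T (i', j').
Proof. by move=> /eqP/negbTE h; rewrite mvE h eqxx. Qed.

Ltac mv_simp := repeat match goal with
  | |- context [@fun_of_fsfun _ _ _ (mv ?T (?i, ?j) (?i', ?j')) (?k, ?l)] => first
    [ rewrite (@mv_out T i j i' j' k l); [|apply/pair_neq; lia|apply/pair_neq; lia]
    | rewrite (@mv_new T i j i' j'); [|apply/pair_neq; lia] ]
  end.

Lemma mv_inv (D : {fset nat * nat}) (T : tab) i j i' j' :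
  (forall b, (T b != 0) = (b \in D) && (b != (i, j))) ->
  mv (mv T (i, j) (i', j')) (i', j') (i, j) = T.
Proof.
move=> supp; apply/fsfunP => b; rewrite !mvE eqxx.
have T0 : T (i, j) = 0 by apply/eqP; rewrite -[_ == _]negbK supp eqxx andbF.
case: (eqVneq b (i, j)) => [-> //|_].
case: (eqVneq b (i', j')) => [->|//].
by case: (eqVneq (i, j) (i', j')) => [<-|].
Qed.

(** Column j + 1 is strict from row r on, so the entry above the null box is strictly smaller than
    the one just moved to its left, and the reverse slide goes left. *)
Lemma reverse_slide_right D r c T i j : hole D r c T i j ->
  T (i, j.+1) != 0 ->
  reverse_slide r (mv T (i, j) (i, j.+1), (i, j.+1)) = (T, (i, j)).
Proof.
move=> H Tr.
case: (H) => [dD /and3P[ijD /andP[r0 ri] cj] supp mono strict].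
have lt : T (i.-1, j.+1) < T (i, j.+1) by apply: strict => //; lia.
have eu : mv T (i, j) (i, j.+1) (i.-1, j.+1) = T (i.-1, j.+1).
  by mv_simp.
have el : mv T (i, j) (i, j.+1) (i, j) = T (i, j.+1).
  by mv_simp.
rewrite /= leqNgt ri /= eu el lt ltnS (leq_ltn_trans _ cj) //=.
by rewrite move_nullE (mv_inv _ _ supp).
Qed.

(** The entry just moved up is at least its former left neighbour, and a reverse slide resolves ties
    upwards. *)
Lemma reverse_slide_down D r c T i j : hole D r c T i j ->
  T (i.+1, j) != 0 ->
  reverse_slide r (mv T (i, j) (i.+1, j), (i.+1, j)) = (T, (i, j)).
Proof.
move=> H Td.
case: (H) => [dD /and3P[ijD /andP[r0 ri] cj] supp mono strict].
have le : T (i.+1, j.-1) <= T (i.+1, j) by apply: mono => //; lia.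
have eu : mv T (i, j) (i.+1, j) (i, j) = T (i.+1, j).
  by mv_simp.
have el : mv T (i, j) (i.+1, j) (i.+1, j.-1) = T (i.+1, j.-1).
  by mv_simp.
rewrite /= leqNgt leqW //= eu el [T _ < _]ltnNge le andbF.
by rewrite move_nullE (mv_inv _ _ supp).
Qed.

(** The path has s + t - (i + j) moves; the n further ones let the reverse path continue beyond (i,
    j). *)
Lemma slides_reverse D r c T i j Q s t n : slides D r c T i j Q s t ->
  iter (n + (s + t - (i + j))) (reverse_slide r) (Q, (s, t)) =
  iter n (reverse_slide r) (T, (i, j)).
Proof.
move=> S; elim: S n => {T i j Q s t} [T i j H d e|T i j Q s t H e lt S IH|
    T i j Q s t H d lt S IH] n.
- by rewrite subnn addn0.
- have [? ?] := slides_le S.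
  have -> : n + (s + t - (i + j)) = n.+1 + (s + t - (i + j.+1)) by lia.
  by rewrite IH iterSr (reverse_slide_right H).
- have [? ?] := slides_le S.
  have -> : n + (s + t - (i + j)) = n.+1 + (s + t - (i.+1 + j)) by lia.
  by rewrite IH iterSr (reverse_slide_down H).
Qed.

Lemma slides_agree D r c T i j Q s t i' j' : slides D r c T i j Q s t ->
  i' < i \/ j' < j -> Q (i', j') = T (i', j').
Proof.
elim=> // {T i j Q s t} T i j Q s t H e lt S IH h;
  by rewrite IH; [mv_simp|lia].
Qed.

(** A reverse slide prepends a step to a path. Here monotonicity of row i sends the forward slide
    back down; in the next lemma strictness of column j sends it back to the right. *)
Lemma slides_up D r c T i j Q s t : slides D r c T i.+1 j Q s t -> r < i ->
  T (i.+1, j.-1) <= T (i, j) ->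
  slides D r c (mv T (i.+1, j) (i, j)) i j Q s t.
Proof.
move=> S ri lt; have H := slides_start S; have H' := @hole_up _ _ _ _ i.+1 j H ri lt.
case: (H) => [dD /and3P[ijD /andP[r0 _] cj] supp mono strict].
have Hin := hole_in H'; have Hin1 := hole_in H.
have uD : (i, j) \in D by case: H' => _ /andP[].
apply: slides_down; rewrite //= ?(mv_inv _ _ supp) //.
  by apply: Hin => //; apply/pair_neq; lia.
have Tu : T (i, j) != 0 by apply: Hin1 => //; apply/pair_neq; lia.
by mv_simp => ?; apply: mono => //; lia.
Qed.

Lemma slides_left D r c T i j Q s t : slides D r c T i j.+1 Q s t -> c < j ->
  T (i.-1, j.+1) < T (i, j) ->
  slides D r c (mv T (i, j.+1) (i, j)) i j Q s t.
Proof.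
move=> S cj lt; have H := slides_start S; have H' := @hole_left _ _ _ _ i j.+1 H cj lt.
case: (H) => [dD /and3P[ijD /andP[r0 ri] _] supp mono strict].
have Hin := hole_in H'; have Hin1 := hole_in H.
apply: slides_right; rewrite //= ?(mv_inv _ _ supp) //.
  by apply: Hin => //; apply/pair_neq; lia.
by mv_simp => ?; apply: strict => //; lia.
Qed.

(* In row i.+1, a reverse slide cannot move the null box left into column b i; in row i, a
   slide cannot move it right out of column b i. *)
Definition guarded (r s : nat) (b : nat -> nat) (T : tab) : Prop :=
  {homo b : i j / i <= j} /\
  (forall i, r <= i < s -> T (i.+1, b i) <= T (i, (b i).+1)).

(** The guard keeps the reverse slides to the right of b until they are in row r + 1. The inequality
    obtained there says that the next reverse slide would go up into row r. *)
Lemma slides_back D r b T i j Q s t : slides D r (b r) T i j Q s t ->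
  guarded r i b T -> b i.-1 < j ->
  exists T' j', [/\ slides D r (b r) T' r.+1 j' Q s t,
    T' (r.+1, j'.-1) <= T' (r, j') & b r < j'].
Proof.
have [n] := ubnP (i + j); elim: n T i j => // n IH T i j le_n S [bmono g] bj.
have H := slides_start S.
case: (H) => [[Dpos Dle] /and3P[ijD /andP[r0 ri] cj] supp mono strict].
case: i => // i in le_n S g bj H ijD ri supp *; rewrite /= in bj.
case: (ltnP (T (i, j)) (T (i.+1, j.-1))) => lt.
  case: j => // j in le_n S g bj H ijD cj supp lt *.
  (* If b(i) were j, the guard in row i would contradict the inequality that sends the null box to
     the left. *)
  have bj1 : b i < j.
    rewrite ltn_neqAle -ltnS bj andbT; apply/eqP => e.
    by have := g i; rewrite e; move: lt => /=; lia.
  have brj : b r < j by apply: leq_ltn_trans bj1; apply: bmono; lia.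
  apply: (IH _ _ _ _ (slides_left S brj lt) _ bj1); first lia.
  split=> // k ki; have gk := g k ki.
  by have bk : b k <= b i by [apply: bmono; lia]; mv_simp.
case: (ltnP r i) => ri1; last first.
  have ei : i = r by lia.
  by subst; exists T, j.
apply: IH (slides_up S ri1 lt) _ _; first lia; last first.
  by apply: leq_ltn_trans bj; apply: bmono; lia.
split=> // k ki; have gk := g k.
by have bk : b k <= b i by [apply: bmono; lia]; mv_simp; apply: gk; lia.
Qed.

(** Here b(k) is the column in which the path leaves row k. The inequalities are those that made it
    go down; they hold on the initial tableau because boxes below or to the right of the null box
    have not been touched yet. *)
Lemma slides_crossing D r c T i j Q s t : slides D r c T i j Q s t ->
  exists b : nat -> nat, [/\ {homo b : k l / k <= l},
    forall k, j <= b k <= t, forall k, i <= k < s -> (k.+1, b k) \in D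
    & forall k, i <= k < s -> T (k, (b k).+1) != 0 ->
        T (k.+1, b k) <= T (k, (b k).+1)].
Proof.
elim=> {T i j Q s t} [T i j H _ _|T i j Q s t H _ _ S|T i j Q s t H d lt S].
- by exists (fun=> j); split=> // k; lia.
- move=> [b [bmono bj bD g]]; exists b; split=> //.
    by move=> k; have := bj k; lia.
  by move=> k ki; have bjk := bj k; have := g k ki; mv_simp.
- move=> [b [bmono bj bD g]]; have [? ?] := slides_le S.
  exists (fun k => if k <= i then j else b k); split.
  + move=> k l kl; case: (leqP k i) => h; case: (leqP l i) => h' //; try lia.
      by have := bj l; lia.
    exact: bmono.
  + by move=> k; have := bj k; case: ifP; lia.
  + move=> k ki; case: (leqP k i) => h; last by apply: bD; lia.
    by have -> : k = i by [lia]; have [] := hole_supp H d.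
  + move=> k ki; case: (leqP k i) => h; first by have -> : k = i by lia.
    have ki1 : i < k < s by lia.
    by have bjk := bj k; have := g k ki1; mv_simp.
Qed.

(** Here b(k) + 1 is the column in which the path leaves row k. The final entry of (k, b(k) + 1)
    came up from row k + 1, where its left neighbour was not larger; that neighbour is not on the
    path. *)
Lemma slides_guard D r c T i j Q s t : slides D r c T i j Q s t ->
  exists b : nat -> nat, [/\ {homo b : k l / k <= l},
    forall k, j <= (b k).+1 <= t,
    forall k, i <= k < s -> (k.+1, (b k).+1) \in D
    & forall k, i <= k < s -> Q (k.+1, b k) <= Q (k, (b k).+1)].
Proof.
elim=> {T i j Q s t} [T i j H _ _|T i j Q s t H _ _ S|T i j Q s t H d lt S].
- have j0 : 0 < j by case: H => _ /and3P[]; lia.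
  by exists (fun=> j.-1); split=> // k; lia.
- move=> [b [bmono bj bD g]]; exists b; split=> // k.
  by have := bj k; lia.
- have [dD /and3P[_ _ cj] supp mono _] := H.
  move=> [b [bmono bj bD g]]; have [? ?] := slides_le S.
  exists (fun k => if k <= i then j.-1 else b k); split.
  + move=> k l kl; case: (leqP k i) => h; case: (leqP l i) => h' //; try lia.
      by have := bj l; lia.
    exact: bmono.
  + by move=> k; have := bj k; case: ifP; lia.
  + move=> k ki; case: (leqP k i) => h; last by apply: bD; lia.
    have -> : k = i by lia.
    by rewrite (@ltn_predK c) //; have [] := hole_supp H d.
  + move=> k ki; case: (leqP k i) => h; last by apply: g; lia.
    have -> : k = i by lia.
    rewrite (@ltn_predK c) // !(slides_agree S); try lia.
    by mv_simp; apply: mono; lia.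
Qed.

(** In column b(k) of row k the null box cannot move right, so it stays weakly left of b. There a
    box below it always exists, because (k + 1, b(k)) is one, so the path cannot stop before row
    m. *)
Lemma slides_escape D r c T i j Q s t b m : slides D r c T i j Q s t ->
  {homo b : k l / k <= l} ->
  (forall k, i <= k < m -> 0 < b k -> T (k.+1, b k) != 0) ->
  (forall k, i <= k < m -> T (k.+1, b k) <= T (k, (b k).+1)) ->
  (i < m -> j <= b i) -> m <= s.
Proof.
move=> S bmono; elim: S => {T i j Q s t} [T i j H d e|T i j Q s t H e lt S IH|
    T i j Q s t H d lt S IH] bD g jb.
- rewrite leqNgt; apply/negP => im.
  have j0 : 0 < j by case: H => _ /and3P[]; lia.
  have bi := jb im.
  have [dD _ supp _ _] := H.
  have := bD i; rewrite leqnn im => /(_ isT) h.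
  have {}h := h (leq_trans j0 bi).
  have [iD _] := hole_supp H h.
  suff : T (i.+1, j) != 0 by rewrite d.
  apply: (hole_in H); last by apply/pair_neq; lia.
  by apply: (dD.2 _ _ _ _ iD); lia.
- have j0 : 0 < j by case: H => _ /and3P[]; lia.
  have bj1 : i < m -> j < b i.
    move=> im; rewrite ltn_neqAle jb // andbT; apply/eqP => ej.
    have im' : i <= i < m by rewrite leqnn.
    have := g _ im'; have := bD _ im'; rewrite -ej; lia.
  apply: IH => // k ki; have bik : b i <= b k by [apply: bmono; lia].
    by have h := bD k ki; mv_simp.
  by have h := g k ki; mv_simp.
- have bj k : i <= k < m -> j <= b k.
    by move=> ki; apply: (leq_trans (jb _)); [lia|apply: bmono; lia].
  apply: IH => [k ki|k ki|im]; last by apply: bj; lia.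
    have ki' : i <= k < m by lia.
    by have bk := bj k ki'; have h := bD k ki'; mv_simp.
  have ki' : i <= k < m by lia.
  by have bk := bj k ki'; have h := g k ki'; mv_simp.
Qed.

(** * Slides preserve nu *)

Definition colset (T : tab) (k : nat) : {fset nat} :=
  [fset b.2 | b in finsupp T & T b == k]%fset.

Lemma colsetP (T : tab) (k j : nat) :
  reflect (k != 0 /\ exists i, T (i, j) = k :> nat) (j \in colset T k).
Proof.
apply: (iffP (imfsetP _ _ _ _)) => /= [[[i j'] /andP[] /= ]|[k0 [i e]]].
  by rewrite mem_finsupp => Tb /eqP e ->; rewrite -e; split=> //; exists i.
by exists (i, j) => //=; rewrite inE mem_finsupp e k0 eqxx.
Qed.

Lemma colset_above D r c T i j : hole D r c T i j -> T (i, j.+1) != 0 ->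
  forall i', i' < i -> T (i', j) < T (i, j.+1) /\ T (i', j.+1) < T (i, j.+1).
Proof.
move=> H e i' ii; have [rD _] := hole_supp H e.
case: (H) => [[Dpos Dle] /and3P[ijD /andP[r0 ri] cj] supp mono strict].
have lt : T (i.-1, j.+1) < T (i, j.+1) by apply: strict => //; lia.
have ne : T (i.-1, j.+1) != 0.
  by apply: (hole_in H); [apply: (Dle _ _ _ _ rD)|apply/pair_neq]; lia.
by split; apply: leq_ltn_trans lt; apply: mono => //; lia.
Qed.

(** Only the moved value changes columns. Column j did not contain it, by strictness above and the
    comparison below, and column j + 1 contained it only once; so one column is gained and one is
    lost. *)
Lemma nu_right D r c T i j : hole D r c T i j -> T (i, j.+1) != 0 ->
  (T (i.+1, j) != 0 -> T (i, j.+1) < T (i.+1, j)) ->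
  nu (mv T (i, j) (i, j.+1)) =1 nu T.
Proof.
move=> H e lt k; rewrite /nu -!/(colset _ _).
have above := colset_above H e; have T0 := hole0 H.
have H1 := hole_right H e lt.
case: (H) => [[Dpos Dle] /and3P[ijD /andP[r0 ri] cj] supp mono strict].
have [i0 j0] := Dpos _ _ ijD.
have other l : l <> j -> l <> j.+1 -> 
    (l \in colset (mv T (i, j) (i, j.+1)) k) = (l \in colset T k).
  move=> lj lj1; apply/colsetP/colsetP => -[k0 [i' h]]; split=> //; exists i';
    move: h; by mv_simp.
case: (eqVneq k (T (i, j.+1))) => [ek|nk].
  subst k.
  have jin : j \in colset (mv T (i, j) (i, j.+1)) (T (i, j.+1)).
    by apply/colsetP; split; [|exists i; mv_simp].
  have jout : j \notin colset T (T (i, j.+1)).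
    apply/colsetP => -[k0 [i' h]].
    case: (ltngtP i' i) => ii; [by have [] := above _ ii; rewrite h ltnn| |].
      have i'D : (i', j) \in D by case: (@hole_supp _ _ _ _ _ _ (i', j) H); rewrite ?h.
      have d : T (i.+1, j) != 0.
        by apply: (hole_in H); [apply: (Dle _ _ _ _ i'D)|apply/pair_neq]; lia.
      have := lt d; have : T (i.+1, j) <= T (i', j) by apply: mono; rewrite ?h.
      by rewrite h; lia.
    by move: e; rewrite -h ii T0.
  have jin' : j.+1 \in colset T (T (i, j.+1)).
    by apply/colsetP; split; [|exists i].
  have jout' : j.+1 \notin colset (mv T (i, j) (i, j.+1)) (T (i, j.+1)).
    apply/colsetP => -[k0 [i' h]].
    case: (ltngtP i' i) => ii.
    - by move: h; mv_simp => h; have [] := above _ ii; rewrite h ltnn.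
    - move: h; mv_simp => h.
      have : T (i, j.+1) < T (i', j.+1) by apply: strict; rewrite ?h //; lia.
      by rewrite h ltnn.
    - by move: e; rewrite -h ii mvE eqxx.
  rewrite (cardfsD1 j) jin [RHS](cardfsD1 j.+1) jin'; congr (_ + #|` _|).
  apply/fsetP => l; rewrite !in_fsetD1.
  case: (eqVneq l j) => [->|lj]; first by rewrite (negbTE jout) andbF.
  case: (eqVneq l j.+1) => [->|lj1]; first by rewrite (negbTE jout').
  by rewrite other //; apply/eqP.
congr (#|` _|); apply/fsetP => l.
apply/colsetP/colsetP => -[k0 [i' h]]; split=> //.
  move: h; rewrite mvE; case: ifP => [_ h|_]; first by rewrite -h in k0.
  by case: ifP => [_ h|_ h]; [rewrite -h eqxx in nk|exists i'].
exists i'; rewrite mvE; case: eqP => [[ei ej]|_].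
  by move: nk; rewrite -h ei ej eqxx.
by case: eqP => [[ei ej]|//]; move: k0; rewrite -h ei ej T0.
Qed.

Lemma nu_down D r c T i j : hole D r c T i j ->
  nu (mv T (i, j) (i.+1, j)) =1 nu T.
Proof.
move=> H k; rewrite /nu -!/(colset _ _); have T0 := hole0 H.
congr (#|` _|); apply/fsetP => l.
apply/colsetP/colsetP => -[k0 [i' h]]; split=> //.
  move: h; rewrite mvE; case: ifP => [_ h|_]; first by rewrite -h in k0.
  by case: eqP => [[_ ->] h|_ h]; [exists i.+1|exists i'].
case: (@eqP _ (i', l) (i.+1, j)) => [[ei ej]|/eqP/negbTE ne].
  by exists i; subst; mv_simp.
exists i'; rewrite mvE ne; case: eqP => [[ei ej]|//].
by move: k0; rewrite -h ei ej T0.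
Qed.

Lemma slides_nu D r c T i j Q s t : slides D r c T i j Q s t -> nu Q =1 nu T.
Proof.
elim=> // {T i j Q s t} T i j Q s t H e lt S IH k; rewrite IH.
  exact: (nu_right H).
exact: (nu_down H).
Qed.

(** * The last pair of equal vertical neighbours in Q *)

Lemma bigmax_seq_eq (T : eqType) (s : seq T) (P : pred T) (F : T -> nat) x :
  x \in s -> P x -> (forall y, y \in s -> P y -> F y <= F x) ->
  \max_(y <- s | P y) F y = F x.
Proof.
move=> xs Px le; apply/eqP; rewrite eqn_leq (leq_bigmax_seq _ xs Px) andbT.
exact/bigmax_leqP_seq.
Qed.

Lemma bigmax_seq_ex (T : eqType) (s : seq T) (P : pred T) (F : T -> nat) :
  0 < \max_(y <- s | P y) F y ->
  exists x, [/\ x \in s, P x & F x = \max_(y <- s | P y) F y].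
Proof.
elim: s => [|a s IH]; first by rewrite big_nil.
rewrite big_cons; case: ifP => Pa; last first.
  by move=> /IH[x [xs Px e]]; exists x; rewrite inE xs orbT.
move=> h; case: (leqP (\max_(y <- s | P y) F y) (F a)) => le.
  by exists a; rewrite inE eqxx; split=> //; apply/esym/maxn_idPl.
have [x [xs Px e]] : exists x, [/\ x \in s, P x & F x = \max_(y <- s | P y) F y].
  by apply: IH; lia.
by exists x; rewrite inE xs orbT; split=> //; rewrite e; apply/esym/maxn_idPr/ltnW.
Qed.

Lemma eq_belowE (Q : tab) i j :
  eq_below Q (i, j) = (Q (i.+1, j) != 0) && (Q (i, j) == Q (i.+1, j)).
Proof. by rewrite /eq_below mem_finsupp. Qed.

Lemma f1_ge (Q : tab) i j : eq_below Q (i, j) -> i <= f1 Q.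
Proof.
move=> h; have := h; rewrite eq_belowE => /andP[n /eqP e].
apply: (@leq_bigmax_seq _ _ _ (fun b => b.1) (i, j)) => //.
by rewrite mem_finsupp e.
Qed.

Lemma f1'_ge (Q : tab) j : eq_below Q (f1 Q, j) -> j <= f1' Q.
Proof.
move=> h; have := h; rewrite eq_belowE => /andP[n /eqP e].
apply: (@leq_bigmax_seq _ _ _ (fun b => b.2) (f1 Q, j)) => //=.
  by rewrite mem_finsupp e.
by rewrite eqxx.
Qed.

Lemma f1P D Q : validQ D Q -> 0 < f1 Q -> eq_below Q (f1 Q, f1' Q).
Proof.
move=> [[Dpos _] supp _] f0.
have [[i j] /= [b eb e]] := bigmax_seq_ex f0; subst i.
have h : 0 < f1' Q.
  by apply: leq_trans (f1'_ge eb); move: b; rewrite mem_finsupp supp => /Dpos[].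
have [[i j'] /= [b' /andP[/eqP ei eb'] e]] := bigmax_seq_ex h.
by move: eb'; rewrite ei e.
Qed.

Lemma f1_eq (Q : tab) r j : eq_below Q (r, j) ->
  (forall i k, eq_below Q (i, k) -> i <= r /\ (i = r -> k <= j)) ->
  f1 Q = r /\ f1' Q = j.
Proof.
move=> h le; have inQ : (r, j) \in finsupp Q.
  by move: h; rewrite eq_belowE mem_finsupp => /andP[n /eqP ->].
have e : f1 Q = r.
  apply: (@bigmax_seq_eq _ _ _ (fun b => b.1) (r, j)) => //.
  by move=> [i k] _ /le[].
split=> //; apply: (@bigmax_seq_eq _ _ _ (fun b => b.2) (r, j)) => //.
  by rewrite e eqxx.
by move=> [i k] _ /= /andP[/eqP ei /le[_ ->]] //; rewrite ei.
Qed.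

(** Columns increase weakly, so an equality between distant rows would give one between adjacent
    rows. *)
Lemma strict_eq_below D Q r c : validQ D Q ->
  (forall i j, eq_below Q (i, j) -> i <= r /\ (i = r -> j <= c)) ->
  strict_below r c Q.
Proof.
move=> [dD supp mono] le i i' j ri cj ii n.
case: (posnP i) => [i0|i0].
  have -> : Q (i, j) = 0; last by lia.
  by apply/eqP; rewrite -[_ == _]negbK supp; apply/negP => /(proj1 dD)[]; lia.
have iD : (i', j) \in D by rewrite -supp.
have [? j0] := dD.1 _ _ iD.
have n1 : Q (i.+1, j) != 0 by rewrite supp; apply: (dD.2 _ _ _ _ iD); lia.
have le1 : Q (i.+1, j) <= Q (i', j) by apply: mono.
apply: leq_trans le1; rewrite ltn_neqAle mono // andbT; apply/negP => e.
have [] : i <= r /\ (i = r -> j <= c) by apply: le; rewrite eq_belowE n1 e.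
move=> ir h; have ei : i = r by lia.
have := cj (esym ei); have := h ei; lia.
Qed.

Lemma strict_f1 D Q : validQ D Q -> strict_below (f1 Q) (f1' Q) Q.
Proof.
move=> V; apply: (strict_eq_below V) => i j h; split; first exact: f1_ge h.
by move=> e; apply: f1'_ge; rewrite -e.
Qed.

Lemma strict_f1_lt D Q r : validQ D Q -> f1 Q < r -> strict_below r 0 Q.
Proof.
move=> V lt; apply: (strict_eq_below V) => i j h; have := f1_ge h; split; lia.
Qed.

Lemma strict_not_eq_below r c (Q : tab) i j : strict_below r c Q ->
  r <= i -> (r = i -> c < j) -> ~~ eq_below Q (i, j).
Proof.
move=> st ri cj; rewrite eq_belowE; apply/negP => /andP[n /eqP e].
by have := st _ _ _ ri cj (ltnSn i) n; rewrite e ltnn.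
Qed.

Lemma strict_f1_le D r c Q : validQ D Q -> strict_below r c Q ->
  f1 Q <= r /\ (f1 Q = r -> f1' Q <= c).
Proof.
move=> V st; case: (posnP (f1 Q)) => f0.
  (* With f1(Q) = 0 a column bound beyond c would come from an equality in row 0, which strictness
     excludes too. *)
  split=> [|e]; first by rewrite f0.
  rewrite leqNgt; apply/negP => lt.
  have h : 0 < f1' Q by lia.
  have [[i j'] /= [b' /andP[/eqP ei eb'] e']] := bigmax_seq_ex h.
  have := strict_not_eq_below (i := i) (j := j') st.
  by rewrite eb' ei e e' => /(_ (leqnn _)); move/(_ (fun=> lt)).
have eb := f1P V f0.
have ne := strict_not_eq_below (i := f1 Q) (j := f1' Q) st.
rewrite eb in ne; split=> [|e]; rewrite leqNgt; apply/negP => lt.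
  by apply/negP: isT; apply: ne; lia.
by apply/negP: isT; apply: ne; lia.
Qed.

(* The tableau T with null box (r.+1, j) is the result of the first slide on fill T r j. *)
Definition fill (T : tab) (r j : nat) : tab :=
  [fsfun T with (r.+1, j) |-> T (r, j)].

Lemma fillE T r j i k : fill T r j (i, k) =
  if (i == r.+1) && (k == j) then T (r, j) else T (i, k).
Proof. by rewrite /fill fsfun_withE. Qed.

Lemma hole_above D r c T j : hole D r c T r.+1 j ->
  [/\ 0 < r, c < j & T (r, j) != 0].
Proof.
move=> H; have [[_ Dle] /and3P[jD /andP[r0 _] cj] _ _ _] := H; split=> //.
by apply: (hole_in H); [apply: (Dle _ _ _ _ jD)|apply/pair_neq]; lia.
Qed.

Lemma fill_valid D r c T j : hole D r c T r.+1 j ->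
  T (r.+1, j.-1) <= T (r, j) -> validQ D (fill T r j).
Proof.
move=> H le; have [r0 cj neT] := hole_above H.
have [dD /and3P[jD _ _] supp mono _] := H; have [Dpos Dle] := dD.
split=> // [[i k]|i k i' k' ii kk].
  rewrite fillE; case: ifP => [/andP[/eqP -> /eqP ->]|]; first by rewrite neT jD.
  by rewrite supp xpair_eqE => ->; rewrite andbT.
rewrite !fillE; case: ifP => [/andP[/eqP ? /eqP ?]|n1];
  case: ifP => [/andP[/eqP ? /eqP ?]|n2] //.
- move=> _; subst; case: (ltnP i r.+1) => ir; first by apply: mono.
  have -> : i = r.+1 by lia.
  apply: leq_trans le; case: (ltnP k j.-1) => kj1; last first.
    by have -> : k = j.-1 by lia.
  apply: mono; try lia.
  by apply: (hole_in H); [apply: (Dle _ _ _ _ jD)|apply/pair_neq]; lia.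
- by move=> n; apply: mono => //; lia.
- exact: mono.
Qed.

Lemma fill_strict D r c T j : hole D r c T r.+1 j -> strict_below r j (fill T r j).
Proof.
move=> H; have [r0 cj neT] := hole_above H; have [_ _ _ mono st] := H.
move=> i i' k ri ck ii; rewrite !fillE;
  case: ifP => [/andP[/eqP ? /eqP ?]|n1]; case: ifP => [/andP[/eqP ? /eqP ?]|n2];
  try lia; subst=> n; apply: st => //; lia.
Qed.

Lemma fill_f1 D r c T j : hole D r c T r.+1 j -> 
  f1 (fill T r j) = r /\ f1' (fill T r j) = j.
Proof.
move=> H; have [r0 cj neT] := hole_above H; have st := fill_strict H.
apply: f1_eq => [|i k eb].
  by rewrite eq_belowE !fillE !eqxx /= neT ifN //; lia.
split; [|move=> ei]; rewrite leqNgt; apply/negP => lt; move: eb; apply/negP.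
  by apply: (strict_not_eq_below st); lia.
by apply: (strict_not_eq_below st); lia.
Qed.

Lemma fill_nu D r c T j : hole D r c T r.+1 j -> nu (fill T r j) =1 nu T.
Proof.
move=> H k; rewrite /nu -!/(colset _ _); congr (#|` _|); apply/fsetP => l.
apply/colsetP/colsetP => -[k0 [i h]]; split=> //.
  move: h; rewrite fillE; case: ifP => [/andP[_ /eqP ->] h|_ h]; last by exists i.
  by exists r.
exists i; rewrite fillE ifN //; apply/negP => /andP[/eqP ei /eqP el].
by move: k0; rewrite -h ei el (hole0 H).
Qed.

(** The right neighbour of (r, j) is at least T (r, j), the value below, and ties go down; so the
    first slide of F moves the lower copy up and leaves T. This uses one of the slides of F. *)
Lemma F_full_fill D r c T j : hole D r c T r.+1 j ->
  T (r.+1, j.-1) <= T (r, j) ->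
  F_full (fill T r j) = iter #|` D|.-1 slide (T, (r.+1, j)).
Proof.
move=> H le; have [r0 cj neT] := hole_above H; have [ef1 ef1'] := fill_f1 H.
have [dD supp _] := fill_valid H le; have [_ /and3P[jD _ _] _ mono _] := H.
have -> : D = finsupp (fill T r j).
  by apply/fsetP => b; rewrite mem_finsupp supp.
rewrite /F_full ef1 ef1'.
set Q0 := [fsfun fill T r j with (r, j) |-> 0].
have Q0E i k : Q0 (i, k) = if (i == r) && (k == j) then 0 else fill T r j (i, k).
  by rewrite /Q0 fsfun_withE.
have d : (r.+1, j) \in finsupp Q0.
  by rewrite mem_finsupp Q0E ifN ?fillE ?eqxx //; lia.
have e : Q0 (r.+1, j) = T (r, j).
  by rewrite Q0E ifN ?fillE ?eqxx //; lia.
have e' : Q0 (r, j.+1) = T (r, j.+1).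
  by rewrite Q0E ifN ?fillE ?ifN //; lia.
have -> : #|` finsupp (fill T r j)| = #|` finsupp (fill T r j)|.-1.+1.
  rewrite (@ltn_predK 0) // cardfs_gt0; apply/fset0Pn; exists (r.+1, j).
  by rewrite mem_finsupp supp.
rewrite iterSr /=; congr iter; rewrite d /=.
rewrite ifN; last first.
  rewrite mem_finsupp e e'; apply/negP => /andP[n lt].
  by have : T (r, j) <= T (r, j.+1) by [apply: mono => //; lia]; lia.
congr pair; apply/fsfunP => -[i k].
rewrite fsfun_withE xpair_eqE; case: ifP => [/andP[/eqP -> /eqP ->]|n].
  by rewrite (hole0 H).
rewrite fsfun_withE xpair_eqE; case: ifP => [/andP[/eqP -> /eqP ->]|n'] //.
by rewrite Q0E n' fillE n.
Qed.

Lemma F_fill D r c T j Q s t : slides D r c T r.+1 j Q s t ->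
  T (r.+1, j.-1) <= T (r, j) ->
  [/\ Fmap (fill T r j) = Q, f2 (fill T r j) = s & f2' (fill T r j) = t].
Proof.
move=> S le; have H := slides_start S; have [H' _ _] := slides_end S.
have [dD /and3P[sD _ _] _ _ _] := H'.
have sz := diagram_card dD sD; have [r0 cj _] := hole_above H.
by rewrite /Fmap /f2 /f2' (F_full_fill H le) (slides_iter S) //; lia.
Qed.

(** The bound is the column before f1'(Q), since [hole] wants it strictly left of the null box.
    Column f1'(Q) itself becomes strict from row f1(Q) on once the lower of the two equal entries is
    erased. *)
Lemma unfill D Q : validQ D Q -> 0 < f1 Q ->
  exists T, [/\ hole D (f1 Q) (f1' Q).-1 T (f1 Q).+1 (f1' Q),
    T ((f1 Q).+1, (f1' Q).-1) <= T (f1 Q, f1' Q) & Q = fill T (f1 Q) (f1' Q)].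
Proof.
move=> V f0; have eb := f1P V f0; have st := strict_f1 V.
set r := f1 Q in f0 eb st *; set c := f1' Q in eb st *.
move: eb; rewrite eq_belowE => /andP[n /eqP e].
have [dD supp mono] := V; have [Dpos Dle] := dD.
have rD : (r.+1, c) \in D by rewrite -supp.
have [_ c0] := Dpos _ _ rD.
pose T := [fsfun Q with (r.+1, c) |-> 0].
have TE i k : T (i, k) = if (i == r.+1) && (k == c) then 0 else Q (i, k).
  by rewrite /T fsfun_withE.
exists T; split; last 1 first.
- apply/fsfunP => -[i k]; rewrite fillE !TE.
  case: ifP => [/andP[/eqP -> /eqP ->]|-> //].
  by rewrite ifN ?e //; lia.
- split=> //.
  + by rewrite rD f0; lia.
  + move=> [i k]; rewrite TE xpair_eqE -supp; case: ifP => _; rewrite ?andbF ?andbT //.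
  + move=> i k i' k' ii kk; rewrite !TE; case: ifP => // _; case: ifP => // _.
    exact: mono.
  + move=> i i' k ri ck ii; rewrite !TE; case: ifP => // n1; case: ifP => // n2 nQ.
      by rewrite lt0n.
    case: (eqVneq i r) => ei; last by apply: st => //; lia.
    case: (eqVneq k c) => ek; last by apply: st => //; lia.
    subst i k; rewrite e; apply: st => //; lia.
- rewrite !TE !ifN; try lia.
  by rewrite e; apply: mono => //; lia.
Qed.

(** The reverse slides retrace the path to row r + 1, one more goes up into row r, and the rest are
    idle. That last move copies T (r, j) down, and restoring the entry of (r, j), which no slide has
    changed before, leaves it in both boxes. *)
Lemma check_phi_fill D c P T j Q : 
  slides D (r1 P) c T (r1 P).+1 j Q (r2 P) (r2' P) ->
  T ((r1 P).+1, j.-1) <= T (r1 P, j) -> check_phi P Q = fill T (r1 P) j.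
Proof.
move=> S le; have [? ?] := slides_le S; have H := slides_start S.
have [r0 cj neT] := hole_above H.
rewrite /check_phi.
have -> : r2 P + r2' P = ((r1 P).+1 + j).-1.+1 + (r2 P + r2' P - ((r1 P).+1 + j)).
  by lia.
rewrite (slides_reverse _ S) iterSr /= leqNgt ltnSn /= [T _ < _]ltnNge le andbF.
rewrite iter_fix /=; last by rewrite leqnn.
rewrite (slides_agree S); last by left.
apply/fsfunP => -[i k]; rewrite fillE !fsfun_withE !xpair_eqE.
case: (eqVneq i (r1 P)) => [->|_]; case: (eqVneq k j) => [->|_] //=;
  by rewrite ?andbF ?andbT ?ltn_eqF.
Qed.

Lemma slides_valid D r c T i j Q s t : slides D r c T i j Q s t ->
  [/\ validQ (D `\ (s, t))%fset Q, strict_below r c Q & (s, t) \in D].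
Proof.
move=> S; have [H d e] := slides_end S.
have [[Dpos Dle] /and3P[sD /andP[r0 rs] ct] supp mono st] := H.
split=> //; split=> //; last by move=> b; rewrite supp in_fsetD1 andbC.
split=> [k l|k l k' l']; first by rewrite in_fsetD1 => /andP[_ /Dpos].
rewrite !in_fsetD1 => /andP[/eqP ne kD] hk hl.
rewrite (Dle _ _ _ _ kD hk hl) andbT; apply/eqP => -[ek el].
case: (ltnP s k) => sk.
  suff : Q (s.+1, t) != 0 by rewrite d.
  apply: (hole_in H); [apply: (Dle _ _ _ _ kD)|apply/pair_neq]; lia.
case: (ltnP t l) => tl.
  suff : Q (s, t.+1) != 0 by rewrite e.
  apply: (hole_in H); [apply: (Dle _ _ _ _ kD)|apply/pair_neq]; lia.
apply: ne; congr pair; lia.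
Qed.

(** A null box added at an outer corner is a path of length zero, the starting point for
    [slides_back]. *)
Lemma valid_hole D r c Q s t : validQ D Q -> strict_below r c Q ->
  diagram ((s, t) |` D)%fset -> (s, t) \notin D -> 0 < r < s -> c < t ->
  slides ((s, t) |` D)%fset r c Q s t Q s t.
Proof.
move=> [[Dpos Dle] supp mono] st dD sD rs ct.
have notin k l : (k, l) \in D -> s <= k -> t <= l -> False.
  move=> kD sk tl; move/negP: sD; apply; apply: (Dle _ _ _ _ kD); lia.
have zero k l : s <= k -> t <= l -> Q (k, l) = 0.
  move=> sk tl; apply/eqP; rewrite -[_ == _]negbK supp; apply/negP => kD.
  exact: notin kD sk tl.
apply: slides_stop; [|by apply: zero; lia|by apply: zero; lia].
split=> //; first by rewrite in_fset1U eqxx rs ct.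
move=> b; rewrite supp in_fset1U; case: eqP => [->|_]; last by rewrite andbT.
by rewrite (negbTE sD).
Qed.

(** * Statistics *)

Lemma card_fset_filterC (T : choiceType) (A : {fset T}) (p : pred T) :
  #|` [fset x in A | p x]%fset| + #|` [fset x in A | ~~ p x]%fset| = #|` A|.
Proof. by rewrite !card_fset_sum1 [RHS](big_fsetID _ p). Qed.

Lemma card_fset_fibers (T : choiceType) (A : {fset T}) (f : T -> nat) N :
  (forall x, x \in A -> f x < N) ->
  \sum_(k < N) #|` [fset x in A | f x == k]%fset| = #|` A|.
Proof.
move=> fN; transitivity (\sum_(k < N) \sum_(x <- A | f x == k) 1).
  by apply: eq_bigr => k _; rewrite card_fset_sum1 -big_fset_condE.
rewrite (exchange_big_dep xpredT) //= [RHS]card_fset_sum1 big_seq [RHS]big_seq.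
apply: eq_bigr => x /fN fx.
by rewrite (big_pred1 (Ordinal fx)) // => k; rewrite -val_eqE eq_sym.
Qed.

(** A column containing k is represented by its lowest box with entry k; these are the boxes with
    entry k that do not agree with a box below. *)
Lemma nu_bottom D Q k : validQ D Q -> nu Q k =
  #|` [fset b in [fset b in finsupp Q | ~~ eq_below Q b] | Q b == k]%fset|.
Proof.
move=> [dD supp mono]; have [Dpos Dle] := dD.
set B := (X in _ = #|` X|).
have BP i j : (i, j) \in B ->
    [/\ Q (i, j) != 0, Q (i, j) = k & Q (i.+1, j) != k].
  rewrite !inE /= mem_finsupp eq_belowE => /andP[/andP[n n'] /eqP e].
  split=> //; apply: contra n' => /eqP e'.
  by rewrite e e' -e n eqxx.
rewrite -(@card_in_imfset imfset_key _ _ (fun b => b.2) (mem B)) /=.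
  congr (#|` _|); apply/fsetP => j; apply/colsetP/imfsetP => /=.
    case=> k0 [i e].
    have [m /eqP em lm] : exists2 m, Q (m, j) == k & forall i, Q (i, j) == k -> i <= m.
      have ex : exists i, Q (i, j) == k by exists i; rewrite e.
      have ub i' : Q (i', j) == k -> i' <= #|` D|.+1.
        move=> /eqP e'; have iD : (i', j) \in D by rewrite -supp e'.
        by have := diagram_card dD iD; lia.
      by case: (ex_maxnP ex ub) => m; exists m.
    exists (m, j) => //; rewrite !inE /= mem_finsupp em k0 eqxx andbT /=.
    rewrite eq_belowE; apply/negP => /andP[_]; rewrite em eq_sym => h.
    by have := lm _ h; rewrite ltnn.
  move=> [[i j'] /= /BP[n e _] ->]; split; first by rewrite -e.
  by exists i.
move=> [i j] [i' j'] /BP[n e ne] /BP[n' e' ne'] /= ej; subst j'.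
have lt m m' : Q (m, j) != 0 -> Q (m, j) = k -> Q (m.+1, j) != k ->
    Q (m', j) != 0 -> Q (m', j) = k -> m' <= m.
  move=> h1 h2 h3 h4 h5; rewrite leqNgt; apply/negP => mm.
  have mD : (m', j) \in D by rewrite -supp.
  have [_ j0] := Dpos _ _ mD.
  have h6 : Q (m.+1, j) != 0 by rewrite supp; apply: (Dle _ _ _ _ mD); lia.
  move/eqP: h3; apply; apply/eqP; rewrite eqn_leq -{1}h5 -h2.
  by apply/andP; split; apply: mono.
congr pair; apply/eqP; rewrite eqn_leq; apply/andP.
by split; [apply: (lt i')|apply: (lt i)].
Qed.

Lemma delta_nu D Q N : validQ D Q -> (forall b, Q b < N) ->
  delta Q + \sum_(k < N) nu Q k = #|` D|.
Proof.
move=> V QN; under eq_bigr => k _ do rewrite (nu_bottom _ V).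
rewrite card_fset_fibers // /delta card_fset_filterC; congr (#|` _|).
by apply/fsetP => b; rewrite mem_finsupp; case: V => _ ->.
Qed.

Lemma tab_bounded (Q : tab) : exists N, forall b, Q b < N.
Proof.
exists (\max_(b <- finsupp Q) Q b).+1 => b; rewrite ltnS.
case: (boolP (b \in finsupp Q)) => [bQ|]; last by rewrite memNfinsupp => /eqP ->.
exact: (@leq_bigmax_seq _ _ _ (fun b => Q b)).
Qed.

Lemma delta_card D D' Q Q' : validQ D Q -> validQ D' Q' -> nu Q =1 nu Q' ->
  delta Q + #|` D'| = delta Q' + #|` D|.
Proof.
move=> V V' e; have [N QN] := tab_bounded Q; have [N' QN'] := tab_bounded Q'.
have le b : Q b < N + N' by apply: (leq_trans (QN b)); lia.
have le' b : Q' b < N + N' by apply: (leq_trans (QN' b)); lia.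
have := delta_nu V le; have := delta_nu V' le'.
have -> : \sum_(k < N + N') nu Q' k = \sum_(k < N + N') nu Q k.
  by apply: eq_bigr => k _; rewrite e.
by move=> <- <-; rewrite addnCA addnA addnAC.
Qed.

(** The conditions on maxima and minima are restated for single elements, so that they are vacuous
    at the empty sets outside the diagram. *)
Definition validP (D : {fset nat * nat}) (P : svtab) : Prop :=
  [/\ diagram D, forall b, (P b != fset0) = (b \in D),
      forall b k, k \in P b -> 0 < k,
      forall i i' j a a', a \in P (i, j) -> a' \in P (i', j) -> i < i' -> a < a'
    & forall i j j' a a', a \in P (i, j) -> a' \in P (i, j') -> j < j' ->
        a <= a'].

Lemma mu_sum (P : svtab) N : (forall b k, k \in P b -> k < N) ->
  \sum_(k < N) mu P k = \sum_(b <- finsupp P) #|` P b|.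
Proof.
move=> PN; rewrite /mu.
transitivity (\sum_(k < N) \sum_(b <- finsupp P | val k \in P b) 1).
  by apply: eq_bigr => k _; rewrite card_fset_sum1 -big_fset_condE.
rewrite (exchange_big_dep xpredT) //=; apply: eq_bigr => b _.
rewrite -(@card_fset_fibers _ (P b) id N); last by move=> k /PN.
rewrite [LHS]big_mkcond; apply: eq_bigr => k _; case: ifP => kP.
  have -> : [fset x in P b | x == val k]%fset = [fset val k]%fset.
    by apply/fsetP => x; rewrite !inE /=; case: eqP => [->|]; rewrite ?kP ?andbF.
  by rewrite cardfs1.
apply/esym/eqP; rewrite cardfs_eq0; apply/eqP/fsetP => x; rewrite !inE /=.
by apply/negP => /andP[xP /eqP e]; rewrite -e xP in kP.
Qed.

Lemma svtab_bounded (P : svtab) : exists N, forall b k, k \in P b -> k < N.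
Proof.
exists (\max_(b <- finsupp P) fsmax (P b)).+1 => b k kb; rewrite ltnS.
apply: (@leq_trans (fsmax (P b))).
  exact: (@leq_bigmax_seq _ _ _ (fun k => k)).
case: (boolP (b \in finsupp P)) => [bP|].
  exact: (@leq_bigmax_seq _ _ _ (fun b => fsmax (P b))).
by rewrite memNfinsupp => /eqP e; rewrite e in kb.
Qed.

Lemma eps_card D P : validP D P ->
  eps P + #|` D| = \sum_(b <- finsupp P) #|` P b|.
Proof.
move=> [_ supp _ _ _]; have -> : D = finsupp P.
  by apply/fsetP => b; rewrite mem_finsupp supp.
rewrite /eps card_fset_sum1 -big_split /= big_seq [RHS]big_seq.
by apply: eq_bigr => b; rewrite mem_finsupp -cardfs_gt0 => h; rewrite subnK.
Qed.

Lemma eps_mu D D' P P' : validP D P -> validP D' P' -> mu P =1 mu P' ->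
  eps P + #|` D| = eps P' + #|` D'|.
Proof.
move=> V V' e; rewrite (eps_card V) (eps_card V').
have [N PN] := svtab_bounded P; have [N' PN'] := svtab_bounded P'.
rewrite -(@mu_sum P (N + N')) -?(@mu_sum P' (N + N')).
- by apply: eq_bigr => k _; rewrite e.
- by move=> b k /PN'; lia.
- by move=> b k /PN; lia.
Qed.

(** * Row insertion *)

Lemma rowlenP D i j : diagram D -> ((i, j) \in D) = (0 < j <= rowlen D i).
Proof.
move=> dD; have [Dpos Dle] := dD.
have [m Dm] : exists m, forall j, ((i, j) \in D) = (0 < j <= m).
  case: (boolP ((i, 1) \in D)) => [D1|nD1].
    have ex : exists j, (i, j) \in D by exists 1.
    have ub j' : (i, j') \in D -> j' <= #|` D|.+1.
      by move=> /(diagram_card dD); lia.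
    case: (ex_maxnP ex ub) => m mD le; exists m => j'.
    apply/idP/idP => [jD|h]; first by rewrite le // andbT; case: (Dpos _ _ jD).
    by apply: (Dle _ _ _ _ mD) => //; case: (Dpos _ _ mD); lia.
  exists 0 => j'; apply/idP/idP => [jD|]; last lia.
  case/negP: nD1; have [? ?] := Dpos _ _ jD.
  by apply: (Dle _ _ _ _ jD); lia.
rewrite Dm; suff -> : rowlen D i = m by [].
transitivity (size (map (pair i) (iota 1 m))); last by rewrite size_map size_iota.
apply: perm_size; apply: uniq_perm; first exact: fset_uniq.
  by rewrite map_inj_uniq ?iota_uniq // => ? ? [].
move=> [i' j']; rewrite !inE /=; apply/andP/mapP.
  case=> jD /eqP ei; subst i'; exists j' => //.
  by move: jD; rewrite Dm mem_iota; lia.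
case=> k; rewrite mem_iota => hk [-> ->]; split=> //.
by rewrite Dm; lia.
Qed.

Lemma find_iotaP (p : pred nat) l (j := (find p (iota 1 l)).+1) :
  [/\ j <= l.+1, j <= l -> p j & forall k, 0 < k < j -> ~~ p k].
Proof.
rewrite /j; split.
- by rewrite ltnS (leq_trans (find_size _ _)) // size_iota.
- move=> h; have hs : has p (iota 1 l) by rewrite has_find size_iota.
  by have := nth_find 0 hs; rewrite nth_iota.
- move=> k kj; have kf : k.-1 < find p (iota 1 l) by lia.
  have := before_find 0 kf; rewrite nth_iota.
    by move=> e; have -> : k = 1 + k.-1 by [lia]; rewrite e.
  by apply: leq_trans kf _; rewrite (leq_trans (find_size _ _)) // size_iota.
Qed.

Lemma find_iota_eq (p : pred nat) l c : 0 < c <= l.+1 -> (c <= l -> p c) ->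
  (forall k, 0 < k < c -> ~~ p k) -> (find p (iota 1 l)).+1 = c.
Proof.
move=> cl pc npk; have [jl pj npj] := find_iotaP p l.
set j := (find p _).+1 in jl pj npj *.
case: (ltngtP j c) => // h.
  have /pj : j <= l by lia.
  by apply/contraTeq => _; apply: npk; lia.
have /pc : c <= l by lia.
by apply/contraTeq => _; apply: npj; lia.
Qed.

Lemma fsmax1 k : fsmax [fset k]%fset = k.
Proof. by rewrite /fsmax big_seq_fset1. Qed.

Lemma fsmax0 : fsmax fset0 = 0.
Proof. by rewrite /fsmax big_seq_fset0. Qed.

Lemma fsmax_ge (A : {fset nat}) k : k \in A -> k <= fsmax A.
Proof. by move=> kA; apply: (@leq_bigmax_seq _ _ _ id). Qed.

Lemma fsmax_in (A : {fset nat}) : A != fset0 -> fsmax A \in A.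
Proof.
move=> /fset0Pn[a aA].
case: (posnP (fsmax A)) => h; last first.
  by have [x [xA _ e]] := bigmax_seq_ex h; rewrite /fsmax -e.
by have := fsmax_ge aA; rewrite h leqn0 => /eqP <-.
Qed.

Lemma fset1_card (A : {fset nat}) a : #|` A| <= 1 -> a \in A -> A = [fset a]%fset.
Proof.
move=> A1 aA; apply/esym/eqP; rewrite eqEfcard fsub1set aA /=.
by rewrite cardfs1.
Qed.

(** * Bumps and reverse bumps *)

Definition single_below (r : nat) (P : svtab) : Prop :=
  forall i j, r < i -> #|` P (i, j)| <= 1.

(* The state between two bumps: v is waiting to be inserted into row i, and p is a column of
   row i.-1 from which it may come. *)
Definition pending (D : {fset nat * nat}) (r : nat) (P : svtab) (i v : nat) :
    Prop :=
  [/\ validP D P, 0 < r < i, single_below r P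
    & exists p, [/\ (i.-1, p) \in D,
        forall j a, j <= p -> a \in P (i.-1, j) -> a < v
      & forall j a, p <= j -> a \in P (i, j) -> v < a]].

Lemma valid_mem D P b a : validP D P -> a \in P b -> b \in D.
Proof. by case=> _ supp _ _ _ aP; rewrite -supp; apply/fset0Pn; exists a. Qed.

Lemma valid_ex D P b : validP D P -> b \in D -> exists a, a \in P b.
Proof. by case=> _ supp _ _ _ bD; apply/fset0Pn; rewrite supp. Qed.

Lemma valid_out D P b : validP D P -> b \notin D -> P b = fset0.
Proof. by case=> _ supp _ _ _ bD; apply/eqP; rewrite -[_ == _]negbK supp. Qed.

Lemma valid_finsupp D P : validP D P -> finsupp P = D.
Proof.
by case=> _ supp _ _ _; apply/fsetP => b; rewrite mem_finsupp supp.
Qed.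

Lemma pending_gt0 D r P i v : pending D r P i v -> 0 < v.
Proof.
case=> V _ _ [p [pD lt _]]; have [a aP] := valid_ex V pD.
by apply: leq_ltn_trans (lt _ _ _ aP).
Qed.

(** In column c it suffices to compare with the adjacent rows, since strict columns propagate the
    bounds. The box may be new or old. *)
Lemma valid_with D P i c (A : {fset nat}) : validP D P -> diagram ((i, c) |` D)%fset ->
  A != fset0 -> (forall a, a \in A -> 0 < a) ->
  (forall a a', a \in A -> a' \in P (i.-1, c) -> a' < a) ->
  (forall a a', a \in A -> a' \in P (i.+1, c) -> a < a') ->
  (forall j a a', j < c -> a \in A -> a' \in P (i, j) -> a' <= a) ->
  (forall j a a', c < j -> a \in A -> a' \in P (i, j) -> a <= a') ->
  validP ((i, c) |` D)%fset [fsfun P with (i, c) |-> A].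
Proof.
move=> V dD A0 Apos up down left right.
have [[Dpos Dle] supp pos col row] := V; have [Dpos' Dle'] := dD.
have [i0 c0] := Dpos' _ _ (fset1U1 (i, c) D).
have PE k l : [fsfun P with (i, c) |-> A] (k, l) =
    if (k == i) && (l == c) then A else P (k, l).
  by rewrite fsfun_withE xpair_eqE.
have up' k a a' : k < i -> a \in A -> a' \in P (k, c) -> a' < a.
  move=> ki aA a'P; case: (ltnP k i.-1) => ki1; last first.
    by apply: (up _ _ aA); have -> : i.-1 = k by lia.
  have uD : (i.-1, c) \in ((i, c) |` D)%fset.
    have [? _] := Dpos _ _ (valid_mem V a'P).
    by apply: (Dle' i c); rewrite ?fset1U1 //; lia.
  have {}uD : (i.-1, c) \in D by move: uD; rewrite in_fset1U => /orP[/eqP[]|//]; lia.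
  have [a1 a1P] := valid_ex V uD.
  by apply: (ltn_trans (col _ _ _ _ _ a'P a1P ki1)); apply: up a1P.
have down' k a a' : i < k -> a \in A -> a' \in P (k, c) -> a < a'.
  move=> ki aA a'P; case: (ltnP i.+1 k) => ki1; last first.
    by apply: (down _ _ aA); have -> : i.+1 = k by lia.
  have uD : (i.+1, c) \in D by apply: (Dle _ _ _ _ (valid_mem V a'P)); lia.
  have [a1 a1P] := valid_ex V uD.
  by apply: ltn_trans (col _ _ _ _ _ a1P a'P ki1); apply: down a1P.
split=> //.
- move=> [k l]; rewrite PE in_fset1U xpair_eqE; case: ifP => _ /=; first by rewrite A0.
  exact: supp.
- by move=> [k l] a; rewrite PE; case: ifP => _; [apply: Apos|apply: pos].
- move=> k k' l a a'; rewrite !PE.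
  case: ifP => [/andP[/eqP ? /eqP ?]|n1]; case: ifP => [/andP[/eqP ? /eqP ?]|n2]; subst.
  + by rewrite ltnn.
  + by move=> aA a'P ki; apply: down' aA a'P.
  + by move=> aP a'A ki; apply: up' aP.
  + exact: col.
- move=> k l l' a a'; rewrite !PE.
  case: ifP => [/andP[/eqP ? /eqP ?]|n1]; case: ifP => [/andP[/eqP ? /eqP ?]|n2]; subst.
  + by rewrite ltnn.
  + by move=> aA a'P ki; apply: right aA a'P.
  + by move=> aP a'A ki; apply: left aP.
  + exact: row.
Qed.

Lemma valid_with_in D P i c (A : {fset nat}) : validP D P -> (i, c) \in D ->
  A != fset0 -> (forall a, a \in A -> 0 < a) ->
  (forall a a', a \in A -> a' \in P (i.-1, c) -> a' < a) ->
  (forall a a', a \in A -> a' \in P (i.+1, c) -> a < a') ->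
  (forall j a a', j < c -> a \in A -> a' \in P (i, j) -> a' <= a) ->
  (forall j a a', c < j -> a \in A -> a' \in P (i, j) -> a <= a') ->
  validP D [fsfun P with (i, c) |-> A].
Proof.
move=> V iD; have e : ((i, c) |` D)%fset = D.
  by apply/fsetUidPr; rewrite fsub1set.
by move=> *; rewrite -e; apply: valid_with => //; rewrite e; case: V.
Qed.

Lemma withE (P : svtab) i c A k l : [fsfun P with (i, c) |-> A] (k, l) =
  if (k == i) && (l == c) then A else P (k, l).
Proof. by rewrite fsfun_withE xpair_eqE. Qed.

Lemma with_other (P : svtab) i c A k l : k <> i \/ l <> c ->
  [fsfun P with (i, c) |-> A] (k, l) = P (k, l).
Proof. by move=> h; rewrite withE ifN //; lia. Qed.

Lemma with_same (P : svtab) i c A : [fsfun P with (i, c) |-> A] (i, c) = A.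
Proof. by rewrite fsfun_withE eqxx. Qed.

Lemma single_with r P i c v : single_below r P ->
  single_below r [fsfun P with (i, c) |-> [fset v]%fset].
Proof.
by move=> sb k l rk; rewrite withE; case: ifP => _; [rewrite cardfs1|apply: sb].
Qed.

(** If p < c, then (i, p) is a box whose elements would be both larger than v and at most v. *)
Lemma pending_le D P i v c p : validP D P -> diagram ((i, c) |` D)%fset ->
  (i.-1, p) \in D -> (forall j a, p <= j -> a \in P (i, j) -> v < a) ->
  (forall j a, j < c -> a \in P (i, j) -> a <= v) -> c <= p.
Proof.
move=> V [Dpos Dle] pD gt left; rewrite leqNgt; apply/negP => pc.
have [i0 c0] := Dpos _ _ (fset1U1 (i, c) D).
have [_ p0] : 0 < i.-1 /\ 0 < p by case: V => -[Dpos' _] _ _ _ _; apply: Dpos'.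
have iD : (i, p) \in ((i, c) |` D)%fset.
  by apply: (Dle i c); rewrite ?fset1U1 //; lia.
have {}iD : (i, p) \in D by move: iD; rewrite in_fset1U => /orP[/eqP[]|//]; lia.
have [a aP] := valid_ex V iD.
by have := gt _ _ (leqnn p) aP; have := left _ _ pc aP; lia.
Qed.

Lemma fset1U_in (D : {fset nat * nat}) b : b \in D -> (b |` D)%fset = D.
Proof. by move=> bD; apply/fsetUidPr; rewrite fsub1set. Qed.

Lemma pending_bump D r P i v c v1 : pending D r P i v ->
  P (i, c) = [fset v1]%fset -> v < v1 ->
  (forall j a, j < c -> a \in P (i, j) -> a <= v) ->
  pending D r [fsfun P with (i, c) |-> [fset v]%fset] i.+1 v1.
Proof.
move=> H e lt left; have v0 := pending_gt0 H.
have [V /andP[r0 ri] sb [p [pD ltv gtv]]] := H.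
have [dD supp pos col row] := V; have [Dpos Dle] := dD.
have v1P : v1 \in P (i, c) by rewrite e inE.
have cD := valid_mem V v1P; have [i0 c0] := Dpos _ _ cD.
have cp : c <= p.
  by apply: (pending_le V _ pD gtv left); rewrite fset1U_in.
split.
- apply: valid_with_in => //.
  + by apply/fset0Pn; exists v; rewrite inE.
  + by move=> a /fset1P ->.
  + by move=> a a' /fset1P ->; apply: ltv.
  + move=> a a' /fset1P -> aP; apply: (ltn_trans lt).
    exact: col _ _ _ _ _ v1P aP _.
  + by move=> j a a' jc /fset1P ->; apply: left.
  + move=> j a a' cj /fset1P -> aP; apply: leq_trans (ltnW lt) _.
    exact: row _ _ _ _ _ v1P aP _.
- by rewrite r0; lia.
- exact: single_with.
- exists c; split=> //= j a jc.
    rewrite withE eqxx /=; case: eqP => [_ /fset1P -> //|nj aP].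
    by apply: leq_ltn_trans lt; apply: left aP; lia.
  rewrite with_other; last lia.
  move=> aP; have jD : (i, j) \in D by apply: (Dle _ _ _ _ (valid_mem V aP)); lia.
  have [a0 a0P] := valid_ex V jD.
  apply: leq_ltn_trans (col _ _ _ _ _ a0P aP (ltnSn i)).
  case: (eqVneq c j) => [ej|nj].
    by move: a0P; rewrite -ej e => /fset1P ->.
  by apply: row v1P a0P _; lia.
Qed.

(** The column c that releases v also serves as a column of row i - 1 from which v may have come;
    [pending] asks only for some such column, so the true one need not be known. *)
Lemma pending_unbump D r P i v c v1 : pending D r P i.+1 v1 -> r < i ->
  P (i, c) = [fset v]%fset -> v < v1 ->
  (forall j a, c < j -> a \in P (i, j) -> v1 <= a) ->
  pending D r [fsfun P with (i, c) |-> [fset v1]%fset] i v.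
Proof.
move=> H ri e lt right; have v0 := pending_gt0 H.
have [V /andP[r0 _] sb [p /= [pD ltv gtv]]] := H.
have [dD supp pos col row] := V; have [Dpos Dle] := dD.
have vP : v \in P (i, c) by rewrite e inE.
have cD := valid_mem V vP; have [i0 c0] := Dpos _ _ cD.
have pc : p <= c.
  rewrite leqNgt; apply/negP => cp.
  have [a aP] := valid_ex V pD; have := right _ _ cp aP.
  by have := ltv _ _ (leqnn p) aP; lia.
have uD : (i.-1, c) \in D by apply: (Dle _ _ _ _ cD); lia.
split.
- apply: valid_with_in => //.
  + by apply/fset0Pn; exists v1; rewrite inE.
  + by move=> a /fset1P ->.
  + move=> a a' /fset1P -> aP; apply: ltn_trans lt.
    by apply: col aP vP _; lia.
  + by move=> a a' /fset1P ->; apply: gtv.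
  + move=> j a a' cj /fset1P -> aP; apply: leq_trans (ltnW lt).
    exact: row _ _ _ _ _ aP vP _.
  + by move=> j a a' jc /fset1P ->; apply: right.
- by rewrite r0.
- exact: single_with.
- exists c; split=> // j a jc.
    rewrite with_other; last lia.
    move=> aP; have [a0 a0P] := valid_ex V uD.
    case: (ltnP j c) => jc'; last first.
      have ej : j = c by lia.
      by subst j; apply: col aP vP _; lia.
    apply: leq_ltn_trans (row _ _ _ _ _ aP a0P jc') _.
    by apply: col a0P vP _; lia.
  rewrite withE eqxx /=; case: eqP => [_ /fset1P -> //|nj aP].
  by apply: leq_trans lt _; apply: right aP; lia.
Qed.

Lemma pending_new D r P i v c : pending D r P i v -> (i, c) \notin D ->
  diagram ((i, c) |` D)%fset ->
  (forall j a, j < c -> a \in P (i, j) -> a <= v) ->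
  validP ((i, c) |` D)%fset [fsfun P with (i, c) |-> [fset v]%fset].
Proof.
move=> H cD dU left; have v0 := pending_gt0 H.
have [V /andP[r0 ri] sb [p [pD ltv gtv]]] := H.
have [dD supp pos col row] := V; have [Dpos Dle] := dD.
have [i0 c0] := dU.1 _ _ (fset1U1 (i, c) D).
have cp := pending_le V dU pD gtv left.
have out k l a : i <= k -> c <= l -> a \in P (k, l) -> False.
  move=> ik cl aP; move/negP: cD; apply.
  by apply: (Dle _ _ _ _ (valid_mem V aP)); lia.
apply: valid_with => //.
- by apply/fset0Pn; exists v; rewrite inE.
- by move=> a /fset1P ->.
- by move=> a a' /fset1P ->; apply: ltv.
- by move=> a a' _ /out; case; lia.
- by move=> j a a' jc /fset1P ->; apply: left.
- by move=> j a a' cj _ /out; case; lia.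
Qed.

Lemma pending_remove D r P s t : validP D P -> single_below r P -> 0 < r < s ->
  (s, t) \in D -> diagram (D `\ (s, t))%fset ->
  pending (D `\ (s, t))%fset r [fsfun P with (s, t) |-> fset0] s (fsmax (P (s, t))).
Proof.
move=> V sb rs sD dD'.
have [dD supp pos col row] := V; have [Dpos Dle] := dD.
have [s0 t0] := Dpos _ _ sD; have [a0 a0P] := valid_ex V sD.
have e := fset1_card (sb s t ltac:(lia)) a0P.
have uD : (s.-1, t) \in D by apply: (Dle _ _ _ _ sD); lia.
rewrite e fsmax1.
have sub k l a : a \in [fsfun P with (s, t) |-> fset0] (k, l) -> a \in P (k, l).
  by rewrite withE; case: ifP.
split=> //.
- split=> //.
  + by move=> [k l]; rewrite withE in_fsetD1 xpair_eqE; case: ifP => //=.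
  + by move=> [k l] a /sub; apply: pos.
  + by move=> k k' l a a' /sub aP /sub a'P; apply: col aP a'P.
  + by move=> k l l' a a' /sub aP /sub a'P; apply: row aP a'P.
- by move=> k l rk; rewrite withE; case: ifP => _ //; apply: sb.
- exists t; split.
  + by rewrite in_fsetD1 uD andbT; apply/eqP => -[]; lia.
  + move=> j a jt /sub aP; have [a1 a1P] := valid_ex V uD.
    case: (ltnP j t) => jt'; last first.
      have ej : j = t by lia.
      by subst j; apply: col aP a0P _; lia.
    apply: leq_ltn_trans (row _ _ _ _ _ aP a1P jt') _.
    by apply: col a1P a0P _; lia.
  + move=> j a tj; rewrite withE eqxx /=; case: (ltngtP j t) tj => // nj _ aP.
    have : (s, t.+1) \in D by apply: (Dle _ _ _ _ (valid_mem V aP)); lia.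
    move=> tD; suff : (s, t) \in (D `\ (s, t))%fset by rewrite in_fsetD1 eqxx.
    apply: (dD'.2 s t.+1); try lia.
    by rewrite in_fsetD1 tD andbT; apply/eqP => -[]; lia.
Qed.

(** * Complete insertion paths and their reversal *)

Inductive ins (D : {fset nat * nat}) (r : nat) :
    svtab -> nat -> nat -> svtab -> nat -> nat -> Prop :=
| ins_new P i v c : pending D r P i v -> (i, c) \notin D ->
    diagram ((i, c) |` D)%fset ->
    (forall j a, j < c -> a \in P (i, j) -> a <= v) ->
    ins D r P i v [fsfun P with (i, c) |-> [fset v]%fset] i c
| ins_bump P i v c v1 P' s t : pending D r P i v ->
    P (i, c) = [fset v1]%fset -> v < v1 ->
    (forall j a, j < c -> a \in P (i, j) -> a <= v) ->
    ins D r [fsfun P with (i, c) |-> [fset v]%fset] i.+1 v1 P' s t ->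
    ins D r P i v P' s t.

Lemma ins_pending D r P i v P' s t : ins D r P i v P' s t -> pending D r P i v.
Proof. by case. Qed.

Lemma ins_le D r P i v P' s t : ins D r P i v P' s t -> i <= s.
Proof. by elim=> // *; lia. Qed.

Lemma ins_agree D r P i v P' s t k l : ins D r P i v P' s t -> k < i ->
  P' (k, l) = P (k, l).
Proof.
elim=> {P i v P' s t} [P i v c H cD dU left|P i v c v1 P' s t H e lt left S IH] ki.
  by rewrite with_other //; lia.
by rewrite IH; [rewrite with_other //; lia|lia].
Qed.

Lemma ins_end D r P i v P' s t : ins D r P i v P' s t ->
  [/\ validP ((s, t) |` D)%fset P', single_below r P', (s, t) \notin D,
      diagram D & exists u, P' (s, t) = [fset u]%fset].
Proof.
elim=> // {P i v P' s t} P i v c H cD dU left.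
have [V _ sb _] := H; split=> //; first exact: (pending_new H).
- exact: single_with.
- by case: V.
- by exists v; rewrite with_same.
Qed.

Lemma diagram_add D i c : diagram D -> (i, c) \in D -> (i.+1, c) \notin D ->
  (1 < c -> (i.+1, c.-1) \in D) -> diagram ((i.+1, c) |` D)%fset.
Proof.
move=> [Dpos Dle] uD nD lD; have [i0 c0] := Dpos _ _ uD.
split=> [k l|k l k' l']; rewrite in_fset1U => /orP[/eqP[-> ->] //|kD].
- exact: Dpos kD.
- move=> hk hl; rewrite in_fset1U; apply/orP.
  case: (ltnP k' i.+1) => ki; first by right; apply: (Dle _ _ _ _ uD); lia.
  case: (ltnP l' c) => lc; first by right; apply: (Dle i.+1 c.-1); try apply: lD; lia.
  by left; apply/eqP; congr pair; lia.
- by move=> hk hl; rewrite in_fset1U (Dle _ _ _ _ kD hk hl) orbT.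
Qed.

Definition bump_col (P : svtab) (i v : nat) : nat :=
  (find (fun j => v < fsmax (P (i, j))) (iota 1 (rowlen (finsupp P) i))).+1.

Lemma bump_colE D P i v c : validP D P -> (i, c) \in D \/ diagram ((i, c) |` D)%fset ->
  (forall a, a \in P (i, c) -> v < a) ->
  (forall j a, j < c -> a \in P (i, j) -> a <= v) -> bump_col P i v = c.
Proof.
move=> V cD gt left; rewrite /bump_col (valid_finsupp V).
have [dD _ _ _ _] := V.
apply: find_iota_eq.
- case: cD => [cD|dU].
    by move: cD; rewrite (rowlenP _ _ dD); lia.
  have [i0 c0] := dU.1 _ _ (fset1U1 (i, c) D); rewrite c0 /=.
  case: (ltnP 1 c) => c1; last lia.
  have : (i, c.-1) \in ((i, c) |` D)%fset.
    by apply: (dU.2 i c); rewrite ?fset1U1 //; lia.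
  rewrite in_fset1U (rowlenP _ _ dD) => /orP[/eqP[]|]; lia.
- move=> cl; have c0 : 0 < c.
    case: cD => [/(proj1 dD)[] //|dU].
    by have [] := dU.1 _ _ (fset1U1 (i, c) D).
  apply/gt/fsmax_in; rewrite -cardfs_gt0 cardfs_gt0.
  by have [_ -> _ _ _] := V; rewrite (rowlenP _ _ dD) c0.
- move=> k /andP[k0 kc]; rewrite -leqNgt.
  case: (eqVneq (P (i, k)) fset0) => [->|n0]; first by rewrite fsmax0.
  exact: left kc (fsmax_in n0).
Qed.

Lemma ins_exist D r P i v : pending D r P i v ->
  exists P' s t, ins D r P i v P' s t.
Proof.
have [n] := ubnP (#|` D|.+1 - i); elim: n P i v => // n IH P i v le_n H.
have [V /andP[r0 ri] sb [p [pD ltv gtv]]] := H.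
have [dD supp pos col row] := V; have [Dpos Dle] := dD.
have [] := find_iotaP (fun j => v < fsmax (P (i, j))) (rowlen (finsupp P) i).
rewrite -/(bump_col P i v) (valid_finsupp V); set c := bump_col P i v.
move=> cl gt nle.
have left j a : j < c -> a \in P (i, j) -> a <= v.
  move=> jc aP; have [_ j0] := Dpos _ _ (valid_mem V aP).
  apply: leq_trans (fsmax_ge aP) _; rewrite leqNgt; apply: nle; lia.
case: (leqP c (rowlen D i)) => cl'.
  have cD : (i, c) \in D by rewrite rowlenP.
  have e : P (i, c) = [fset fsmax (P (i, c))]%fset.
    by apply: fset1_card; [apply: sb|apply: fsmax_in; rewrite supp].
  have H' := pending_bump H e (gt cl') left.
  have [|P' [s [t S]]] := IH _ _ _ _ H'.
    by have := diagram_card dD cD; have : 0 < c by []; lia.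
  by exists P', s, t; apply: (ins_bump H e (gt cl') left S).
have ec : c = (rowlen D i).+1 by lia.
have cD : (i, c) \notin D by rewrite rowlenP // ec ltnn andbF.
have [_ p0] := Dpos _ _ pD.
(* The end of row i is not to the right of the source column, so the new box has a box above it. *)
have cp : c <= p.
  rewrite leqNgt; apply/negP => pc.
  have iD : (i, p) \in D by rewrite rowlenP //; lia.
  have [a aP] := valid_ex V iD.
  by have := gtv _ _ (leqnn p) aP; have := left _ _ pc aP; lia.
have ei : i.-1.+1 = i by lia.
exists [fsfun P with (i, c) |-> [fset v]%fset], i, c; apply: ins_new => //.
rewrite -ei; apply: diagram_add; rewrite ?ei //.
  by apply: (Dle _ _ _ _ pD); have := Dpos _ _ pD; lia.
by move=> c1; rewrite rowlenP //; lia.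
Qed.

Lemma ins_row_insert D r P i v P' s t n : ins D r P i v P' s t -> s <= i + n ->
  row_insert n P i v = (P', (s, t)).
Proof.
move=> S; elim: S n => {P i v P' s t} [P i v c H cD dU left|
    P i v c v1 P' s t H e lt left S IH] n le_n.
- have [V _ _ _] := H; have [dD _ _ _ _] := V.
  have ec : bump_col P i v = c.
    apply: (bump_colE V) => //; first by right.
    by move=> a aP; case/negP: cD; apply: valid_mem V aP.
  case: n {le_n} => [|n] /=; rewrite -/(bump_col P i v) ec //.
  rewrite ifN // (valid_finsupp V); apply: contra cD => cl.
  by rewrite rowlenP // cl andbT; have [_ ->] := dU.1 _ _ (fset1U1 (i, c) D).
- have [V _ _ _] := H; have [dD _ _ _ _] := V.
  have v1P : v1 \in P (i, c) by rewrite e inE.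
  have cD := valid_mem V v1P.
  have ec : bump_col P i v = c.
    apply: (bump_colE V) => //; first by left.
    by move=> a; rewrite e => /fset1P ->.
  have is_ := ins_le S.
  case: n le_n => [|n] le_n; first lia.
  rewrite /= -/(bump_col P i v) ec (valid_finsupp V).
  have := cD; rewrite rowlenP // => /andP[_ ->].
  by rewrite e fsmax1; apply: IH; lia.
Qed.

(** Everything to the right of the bumped v1 is at least v1, so the rightmost entry below v1 is the
    v that replaced it. *)
Lemma ins_reverse D r P i v P' s t n : ins D r P i v P' s t ->
  reverse_insert (n + (s - i)) [fsfun P' with (s, t) |-> fset0] s.-1 (fsmax (P' (s, t))) =
  reverse_insert n P i.-1 v.
Proof.
move=> S; elim: S n => {P i v P' s t} [P i v c H cD dU left|
    P i v c v1 P' s t H e lt left S IH] n.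
- have [V _ _ _] := H.
  rewrite subnn addn0 with_same fsmax1; congr reverse_insert.
  apply/fsfunP => -[k l]; rewrite !withE.
  by case: ifP => [/andP[/eqP -> /eqP ->]|-> //]; rewrite (valid_out V).
- have [V _ _ _] := H; have [dD _ _ _ row] := V.
  have v1P : v1 \in P (i, c) by rewrite e inE.
  have cD := valid_mem V v1P.
  have := ins_le S => is_.
  have -> : n + (s - i) = n.+1 + (s - i.+1) by lia.
  have [V1 _ _ _] := ins_pending S.
  rewrite IH /= (valid_finsupp V1).
  set P1 := [fsfun P with (i, c) |-> [fset v]%fset].
  have -> : \max_(j <- iota 1 (rowlen D i) | fsmax (P1 (i, j)) < v1) j = c.
    apply: (@bigmax_seq_eq _ _ _ id).
    - by rewrite mem_iota; move: cD; rewrite rowlenP //; lia.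
    - by rewrite with_same fsmax1.
    - move=> j; rewrite mem_iota => hj lt1; rewrite leqNgt; apply/negP => cj.
      have jD : (i, j) \in D by rewrite rowlenP //; lia.
      have [a aP] := valid_ex V jD; move: lt1; rewrite with_other; last by lia.
      by rewrite ltnNge (leq_trans (row _ _ _ _ _ v1P aP cj) (fsmax_ge aP)).
  rewrite with_same fsmax1; congr reverse_insert.
  apply/fsfunP => -[k l]; rewrite !withE.
  by case: ifP => [/andP[/eqP -> /eqP ->]|-> //].
Qed.

(** Stated with sums on both sides to avoid truncated subtraction. *)
Lemma mu_with (P : svtab) b (A : {fset nat}) k :
  mu [fsfun P with b |-> A] k + (k \in P b) = mu P k + (k \in A).
Proof.
have muE (P' : svtab) : mu P' k =
    (k \in P' b) + #|` [fset x in finsupp P' | k \in P' x] `\ b|%fset.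
  rewrite /mu (cardfsD1 b) !inE /= mem_finsupp; congr (_ + _).
  case: (boolP (k \in P' b)) => [kP|]; rewrite ?andbF // andbT.
  by rewrite -cardfs_gt0 (cardfsD1 k) kP.
rewrite [in LHS]muE [in RHS]muE fsfun_with addnAC [RHS]addnAC [X in X + _]addnC.
congr (_ + #|` _|); apply/fsetP => x; rewrite !inE /= !mem_finsupp fsfun_withE.
by case: eqP.
Qed.

Lemma ins_mu D r P i v P' s t k : ins D r P i v P' s t ->
  mu P' k = mu P k + (k == v).
Proof.
elim=> {P i v P' s t} [P i v c H cD dU left|P i v c v1 P' s t H e lt left S IH].
  have [V _ _ _] := H; have := mu_with P (i, c) [fset v]%fset k.
  by rewrite (valid_out V cD) inE addn0 => ->; rewrite inE.
have := mu_with P (i, c) [fset v]%fset k.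
by rewrite IH e !inE.
Qed.

(** Here u(k) is the integer inserted into row k. Its traces in P serve to bound a reverse insertion
    into P from below, those in P' to bound a second insertion from above. *)
Lemma ins_trace D r P i v P' s t : ins D r P i v P' s t ->
  exists u : nat -> nat, [/\ u i = v,
    forall k, i <= k < s -> u k < u k.+1 /\ exists c, P (k, c) = [fset u k.+1]%fset
    & forall k, i <= k <= s -> exists c, P' (k, c) = [fset u k]%fset /\
        (k < s -> forall j a, j <= c -> a \in P' (k, j) -> a < u k.+1)].
Proof.
elim=> {P i v P' s t} [P i v c H cD dU left|P i v c v1 P' s t H e lt left S].
  exists (fun=> v); split=> // k ki; first by exfalso; lia.
  by exists c; have -> : k = i by [lia]; rewrite with_same; split=> //; lia.
move=> [u [ui uP uP']]; have is_ := ins_le S.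
exists (fun k => if k == i then v else u k); split; first by rewrite eqxx.
- move=> k ki.
  case: (eqVneq k i) => [->|ne]; first by rewrite gtn_eqF // ui; split=> //; exists c.
  rewrite gtn_eqF; last lia.
  have [|lt' [c' e']] := uP k; first lia.
  by split=> //; exists c'; rewrite -e' with_other //; lia.
- move=> k ki; case: (eqVneq k i) => [->|ne]; last first.
    rewrite gtn_eqF; last lia.
    by apply: uP'; lia.
  exists c; rewrite (ins_agree _ S) // with_same; split=> // _ j a jc.
  rewrite (ins_agree _ S) // gtn_eqF // ui withE eqxx /=.
  case: eqP => [_ /fset1P -> //|nj aP].
  by apply: leq_ltn_trans lt; apply: left aP; lia.
Qed.

(* The inserted integers stay below u, which forces a bump in each of the rows i to m. *)
Lemma ins_escape D r P i v P' s t u m : ins D r P i v P' s t ->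
  (forall k, i <= k <= m -> exists c, P (k, c) = [fset u k]%fset /\
     (k < m -> forall j a, j <= c -> a \in P (k, j) -> a < u k.+1)) ->
  (i <= m -> v < u i) -> m < s.
Proof.
elim=> {P i v P' s t} [P i v c H cD dU left|P i v c v1 P' s t H e lt left S IH] g vu.
- rewrite ltnNge; apply/negP => im.
  have [|c' [e' _]] := g i; first by rewrite leqnn.
  have [V _ _ _] := H; have uP : u i \in P (i, c') by rewrite e' inE.
  case: (ltnP c' c) => cc; first by have := left _ _ cc uP; have := vu im; lia.
  move/negP: cD; apply.
  have [dD _ _ _ _] := V.
  apply: (dD.2 _ _ _ _ (valid_mem V uP)); rewrite ?cc ?leqnn ?andbT.
    by have [] := dU.1 _ _ (fset1U1 (i, c) D).
  by have [_ ->] := dU.1 _ _ (fset1U1 (i, c) D).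
- apply: IH => [k ki|im].
    have [|c' [e' h]] := g k; first lia.
    exists c'; rewrite with_other; last lia.
    split=> // km j a jc; rewrite with_other; last lia.
    exact: h.
  have [|c' [e' h]] := g i; first lia.
  have v1P : v1 \in P (i, c) by rewrite e inE.
  (* As v < u(i), the bump happens weakly left of u(i), where all entries are below u(i + 1). *)
  apply: (h im c) => //; rewrite leqNgt; apply/negP => cc.
  have uP : u i \in P (i, c') by rewrite e' inE.
  by have := left _ _ cc uP; have := vu (ltnW im); lia.
Qed.

(** The last conclusion makes v0 the largest entry of row i below v1; this is what a comparison with
    another path needs. *)
Lemma ins_unbump D r P i v1 P' s t : ins D r P i.+1 v1 P' s t -> r < i ->
  exists P0 v0, [/\ ins D r P0 i v0 P' s t,
    forall k l, k < i -> P0 (k, l) = P (k, l)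
    & forall j a, a \in P (i, j) -> a < v1 -> a <= v0].
Proof.
move=> S ri; have H := ins_pending S.
have [V /andP[r0 _] sb [p /= [pD ltv gtv]]] := H.
have [dD supp pos col row] := V; have [Dpos Dle] := dD.
have single j a : a \in P (i, j) -> P (i, j) = [fset a]%fset.
  by apply: fset1_card; apply: sb.
set F := \max_(j <- iota 1 (rowlen D i) | fsmax (P (i, j)) < v1) j.
have le j a : a \in P (i, j) -> a < v1 -> j <= F.
  move=> aP av; apply: (@leq_bigmax_seq _ _ _ id); last by rewrite (single _ _ aP) fsmax1.
  by have := valid_mem V aP; rewrite rowlenP // mem_iota add1n ltnS.
(* The source column p has an entry below v1 in row i, so there is one to release. *)
have F0 : 0 < F.
  have [a aP] := valid_ex V pD; have := le _ _ aP (ltv _ _ (leqnn _) aP).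
  by have := Dpos _ _ pD; lia.
have [c [cl lt ec]] := bigmax_seq_ex F0; rewrite -/F in ec.
move: le; rewrite -{}ec => le {F F0}.
have cD : (i, c) \in D by move: cl; rewrite mem_iota rowlenP // add1n ltnS.
have [v vP] := valid_ex V cD; have e := single _ _ vP.
rewrite e fsmax1 in lt.
have right j a : c < j -> a \in P (i, j) -> v1 <= a.
  by move=> cj aP; rewrite leqNgt; apply/negP => /(le _ _ aP); lia.
exists [fsfun P with (i, c) |-> [fset v1]%fset], v; split.
- apply: (@ins_bump _ _ _ _ _ c v1) => //.
  + exact: pending_unbump.
  + by rewrite with_same.
  + by move=> j a jc; rewrite with_other; [move=> aP; apply: row aP vP jc|lia].
  + set P0 := [fsfun P with (i, c) |-> [fset v1]%fset].
    suff -> : [fsfun P0 with (i, c) |-> [fset v]%fset] = P by [].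
    apply/fsfunP => -[k l]; rewrite !withE.
    by case: ifP => [/andP[/eqP -> /eqP ->]|-> //].
- by move=> k l ki; rewrite with_other //; lia.
- move=> j a aP av; have := le _ _ aP av; rewrite leq_eqVlt => /orP[/eqP ej|jc].
    by move: aP; rewrite ej e => /fset1P ->.
  exact: row aP vP jc.
Qed.

(** Since u(k + 1) lies in row k and is below the integer moving up, the integer released there is
    at least u(k + 1) > u(k); so the reverse path stays above u. The proposition G makes only this
    comparison conditional, as the path itself is always needed. *)
Lemma ins_back D r P i v P' s t (G : Prop) u : ins D r P i v P' s t ->
  (G -> forall k, r < k < i ->
    u k < u k.+1 /\ exists c, P (k, c) = [fset u k.+1]%fset) ->
  (G -> u i < v) ->
  exists P0 v0, ins D r P0 r.+1 v0 P' s t /\ (G -> u r.+1 < v0).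
Proof.
elim: i P v => [|i IH] P v S g uv.
  by have [_ /andP[]] := ins_pending S.
have [_ /andP[r0 ri] _ _] := ins_pending S.
case: (ltnP r i) => ri'; last first.
  have er : r = i by lia.
  by subst i; exists P, v.
have [P0 [v0 [S0 agree le]]] := ins_unbump S ri'.
apply: (IH P0 v0 S0) => [hG k ki|hG].
  have [|lt [c e]] := g hG k; first lia.
  by split=> //; exists c; rewrite agree //; lia.
have [|lt [c e]] := g hG i; first by rewrite ri' ltnSn.
have uP : u i.+1 \in P (i, c) by rewrite e inE.
by apply: leq_trans lt _; apply: le uP (uv hG).
Qed.

(** * The last box of P with several elements *)

Lemma r1_ge (P : svtab) i j : 1 < #|` P (i, j)| -> i <= r1 P.
Proof.
move=> h; apply: (@leq_bigmax_seq _ _ _ (fun b => b.1) (i, j)) => //.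
by rewrite mem_finsupp -cardfs_gt0; apply: leq_trans h.
Qed.

Lemma r1'_ge (P : svtab) j : 1 < #|` P (r1 P, j)| -> j <= r1' P.
Proof.
move=> h; apply: (@leq_bigmax_seq _ _ _ (fun b => b.2) (r1 P, j)); rewrite /= ?eqxx //.
by rewrite mem_finsupp -cardfs_gt0; apply: leq_trans h.
Qed.

Lemma r1P D P : validP D P -> 0 < r1 P -> 1 < #|` P (r1 P, r1' P)|.
Proof.
move=> V f0; have [dD _ _ _ _] := V.
have [[i j] /= [b eb e]] := bigmax_seq_ex f0; rewrite -/(r1 P) in e; subst i.
have h : 0 < r1' P.
  apply: leq_trans (r1'_ge eb).
  by move: b; rewrite (valid_finsupp V) => /(proj1 dD)[].
have [[i j'] /= [b' /andP[/eqP ei eb'] e]] := bigmax_seq_ex h.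
by rewrite -/(r1' P) in e; move: eb'; rewrite ei e.
Qed.

Lemma r1_eq (P : svtab) r j : 1 < #|` P (r, j)| ->
  (forall i k, 1 < #|` P (i, k)| -> i <= r /\ (i = r -> k <= j)) ->
  r1 P = r /\ r1' P = j.
Proof.
move=> h le; have inP : (r, j) \in finsupp P.
  by rewrite mem_finsupp -cardfs_gt0; apply: leq_trans h.
have e : r1 P = r.
  apply: (@bigmax_seq_eq _ _ _ (fun b => b.1) (r, j)) => //.
  by move=> [i k] _ /le[].
split=> //; apply: (@bigmax_seq_eq _ _ _ (fun b => b.2) (r, j)) => //.
  by rewrite e eqxx.
by move=> [i k] _ /= /andP[/eqP ei /le[_ ->]] //; rewrite ei.
Qed.

Lemma single_below_r1 (P : svtab) r : r1 P <= r -> single_below r P.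
Proof.
by move=> le i j ri; rewrite leqNgt; apply/negP => /r1_ge; lia.
Qed.

Lemma single_below_r1_le (P : svtab) r : single_below r P -> r1 P <= r.
Proof.
move=> sb; rewrite leqNgt; apply/negP => lt.
have h : 0 < r1 P by lia.
have [[i j] /= [_ eb e]] := bigmax_seq_ex h; rewrite -/(r1 P) in e.
by have := sb i j; rewrite e => /(_ lt); rewrite leqNgt => /negP; apply; rewrite -e.
Qed.

Definition attach (P : svtab) (r c y : nat) : svtab :=
  [fsfun P with (r, c) |-> (y |` P (r, c))%fset].

(* Inserting y into row r.+1 of P is the first step of the computation of R on
   attach P r c y. *)
Definition attachable (D : {fset nat * nat}) (r : nat) (P : svtab) (c y : nat) :
    Prop :=
  [/\ pending D r P r.+1 y, (r, c) \in D,
      forall j a, j <= c -> a \in P (r, j) -> a < y,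
      forall j a, c < j -> a \in P (r, j) -> y <= a
    & forall j, c < j -> #|` P (r, j)| <= 1].

Lemma attachE P r c y i j : attach P r c y (i, j) =
  if (i == r) && (j == c) then (y |` P (r, c))%fset else P (i, j).
Proof. by rewrite /attach withE. Qed.

Lemma attach_notin D r P c y : attachable D r P c y -> y \notin P (r, c).
Proof. by case=> _ _ lt _ _; apply/negP => /(lt _ _ (leqnn _)); rewrite ltnn. Qed.

Lemma attach_valid D r P c y : attachable D r P c y -> validP D (attach P r c y).
Proof.
move=> [H rD lt ge sg]; have y0 := pending_gt0 H.
have [V /andP[r0 _] sb [p /= [pD ltp gtp]]] := H.
have [dD supp pos col row] := V; have [Dpos Dle] := dD.
have pc : p <= c.
  rewrite leqNgt; apply/negP => cp; have [a aP] := valid_ex V pD.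
  by have := ltp _ _ (leqnn p) aP; have := ge _ _ cp aP; lia.
apply: valid_with_in => //.
- by apply/fset0Pn; exists y; rewrite fset1U1.
- by move=> a /fset1UP[->//|]; apply: pos.
- move=> a a' /fset1UP[->|aP] a'P; last by apply: col a'P aP _; lia.
  have [a1 a1P] := valid_ex V rD; apply: ltn_trans (lt _ _ (leqnn c) a1P).
  by apply: col a'P a1P _; lia.
- move=> a a' /fset1UP[->|aP] a'P; first exact: gtp pc a'P.
  exact: col aP a'P (ltnSn r).
- move=> j a a' jc /fset1UP[->|aP] a'P; first exact: ltnW (lt _ _ (ltnW jc) a'P).
  exact: row a'P aP jc.
- move=> j a a' cj /fset1UP[->|aP] a'P; first exact: ge cj a'P.
  exact: row aP a'P cj.
Qed.

Lemma attach_r1 D r P c y : attachable D r P c y ->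
  r1 (attach P r c y) = r /\ r1' (attach P r c y) = c.
Proof.
move=> A; have yP := attach_notin A.
have [[V _ sb _] rD _ _ sg] := A; have [_ supp _ _ _] := V.
apply: r1_eq => [|i k].
  by rewrite attachE !eqxx /= cardfsU1 yP ltnS cardfs_gt0 supp.
rewrite attachE; case: ifP => [/andP[/eqP -> /eqP ->] //|ne] h; split.
  rewrite leqNgt; apply/negP => ri; have := sb _ k ri; rewrite leqNgt => /negP; exact.
move=> ei; subst i; rewrite leqNgt; apply/negP => /sg; rewrite leqNgt => /negP; exact.
Qed.

Lemma attach_R D r P c y : attachable D r P c y ->
  R_full (attach P r c y) = row_insert #|` D| P r.+1 y.
Proof.
move=> A; have yP := attach_notin A; have [e1 e1'] := attach_r1 A.
have [H rD lt _ _] := A.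
have emax : fsmax (attach P r c y (r, c)) = y.
  rewrite attachE !eqxx /=; apply/eqP; rewrite eqn_leq fsmax_ge ?fset1U1 // andbT.
  set A' := (y |` P (r, c))%fset.
  have /fset1UP[->//|/(lt _ _ (leqnn c))/ltnW//] : fsmax A' \in A'.
  by apply: fsmax_in; apply/fset0Pn; exists y; rewrite fset1U1.
rewrite /R_full e1 e1' emax (valid_finsupp (attach_valid A)); congr row_insert.
apply/fsfunP => -[k l]; rewrite withE !attachE !eqxx /= fsetU1K //.
by case: ifP => [/andP[/eqP -> /eqP ->]|-> //].
Qed.

Lemma attach_mu D r P c y k : attachable D r P c y ->
  mu (attach P r c y) k = mu P k + (k == y).
Proof.
move=> A; have yP := attach_notin A.
have := mu_with P (r, c) (y |` P (r, c))%fset k.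
rewrite in_fset1U; case: eqP => [->|_]; first by rewrite (negbTE yP) addn0.
by rewrite addn0 => /addIn.
Qed.

Lemma detach D P : validP D P -> 0 < r1 P -> exists P0 y,
  attachable D (r1 P) P0 (r1' P) y /\ P = attach P0 (r1 P) (r1' P) y.
Proof.
move=> V r0; have gt1 := r1P V r0.
set r := r1 P in r0 gt1 *; set c := r1' P in gt1 *.
have [dD supp pos col row] := V; have [Dpos Dle] := dD.
pose x := fsmax (P (r, c)).
have xP : x \in P (r, c) by apply: fsmax_in; rewrite -cardfs_gt0; apply: leq_trans gt1.
have rD := valid_mem V xP.
(* A second element z keeps the box nonempty and forces the entries to its left to be strictly below
   x. *)
have [z] : exists z, z \in (P (r, c) `\ x)%fset.
  by apply/fset0Pn; rewrite -cardfs_gt0; move: gt1; rewrite (cardfsD1 x) xP.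
rewrite in_fsetD1 => /andP[zx zP].
have zltx : z < x by rewrite ltn_neqAle zx fsmax_ge.
pose P0 := [fsfun P with (r, c) |-> (P (r, c) `\ x)%fset].
have P0E k l : P0 (k, l) =
    if (k == r) && (l == c) then (P (r, c) `\ x)%fset else P (k, l).
  by rewrite /P0 withE.
have sub k l a : a \in P0 (k, l) -> a \in P (k, l).
  by rewrite P0E; case: ifP => // /andP[/eqP -> /eqP ->]; rewrite in_fsetD1 => /andP[].
have lt j a : j <= c -> a \in P0 (r, j) -> a < x.
  rewrite P0E eqxx /=; case: (ltngtP j c) => // [jc _ aP|_ _].
    by apply: leq_ltn_trans zltx; apply: row aP zP jc.
  by rewrite in_fsetD1 => /andP[ax aP]; rewrite ltn_neqAle ax fsmax_ge.
have sb : single_below r P by apply: single_below_r1.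
exists P0, x; split; last first.
  apply/fsfunP => -[k l]; rewrite attachE !P0E !eqxx /= fsetD1K //.
  by case: ifP => [/andP[/eqP -> /eqP ->]|-> //].
split=> //.
- split=> //.
  + split=> //.
    * move=> [k l]; rewrite P0E; case: ifP => [/andP[/eqP -> /eqP ->]|_ //].
      by rewrite rD; apply/fset0Pn; exists z; rewrite in_fsetD1 zx.
    * by move=> [k l] a /sub; apply: pos.
    * by move=> k k' l a a' /sub aP /sub a'P; apply: col aP a'P.
    * by move=> k l l' a a' /sub aP /sub a'P; apply: row aP a'P.
  + by rewrite r0 ltnSn.
  + by move=> k l rk; rewrite P0E ifN; [apply: sb|lia].
  + exists c; split=> // j a cj /sub aP.
    move: cj; rewrite leq_eqVlt => /orP[/eqP ej|cj].
      by apply: (col r r.+1 c) => //; rewrite ej.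
    have jD : (r, j) \in D.
      by apply: (Dle _ _ _ _ (valid_mem V aP)); have := Dpos _ _ (valid_mem V aP); lia.
    have [a0 a0P] := valid_ex V jD.
    apply: leq_ltn_trans (col _ _ _ _ _ a0P aP (ltnSn r)).
    exact: row xP a0P cj.
- by move=> j a cj /sub aP; apply: row xP aP cj.
- move=> j cj; rewrite P0E eqxx /= gtn_eqF // leqNgt; apply/negP => /r1'_ge.
  by rewrite -/c; lia.
Qed.

Definition row_split (P : svtab) (r c y : nat) : Prop :=
  (forall j a, j <= c -> a \in P (r, j) -> a < y) /\
  (forall j a, c < j -> a \in P (r, j) -> y <= a).

Lemma hat_phi_attach D P Q c P0 y : let r := f1 Q in
  ins D r P0 r.+1 y P (f2 Q) (f2' Q) -> (r, c) \in D -> row_split P0 r c y ->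
  hat_phi P Q = attach P0 r c y.
Proof.
move=> r S rD [lt ge]; have [V /andP[r0 _] _ _] := ins_pending S.
have [dD _ _ _ _] := V; have rs := ins_le S.
rewrite /hat_phi; have := ins_reverse 0 S.
have -> : 0 + (f2 Q - r.+1) = (f2 Q).-1 - r by lia.
move=> -> /=; rewrite (valid_finsupp V).
set p := (X in find X _).
have -> : (find p (iota 1 (rowlen D r))).+1 = c; last by [].
have := rD; rewrite rowlenP // => /andP[c0 cl].
apply: find_iota_eq; first by rewrite c0 ltnW.
  move=> _; apply/andP; split; apply/allP => j; rewrite mem_iota => hj; apply/allP => a.
    by apply: lt; lia.
  by apply: ge; lia.
(* No earlier column splits the row, because the elements of box (r, c) are below y. *)
move=> k /andP[k0 kc]; apply/negP => /andP[_ /allP h].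
have [a aP] := valid_ex V rD.
have /h/allP/(_ _ aP) : c \in iota k.+1 (rowlen D r - k) by rewrite mem_iota; lia.
by rewrite leqNgt (lt _ _ (leqnn c) aP).
Qed.

(** * The two maps *)

Lemma eps_r1 D P : validP D P -> 0 < eps P -> 0 < r1 P.
Proof.
move=> V h; rewrite lt0n; apply/eqP => r0; move: h.
rewrite /eps big1_fset // => -[i j] bP _; apply/eqP; rewrite subn_eq0.
apply: (@single_below_r1 P 0); first by rewrite r0.
by have [dD _ _ _ _] := V; move: bP; rewrite (valid_finsupp V) => /(proj1 dD)[].
Qed.

Lemma delta_f1 D Q : validQ D Q -> 0 < delta Q -> 0 < f1 Q.
Proof.
move=> [dD supp _]; rewrite /delta cardfs_gt0 => /fset0Pn[[i j]].
rewrite !inE /= mem_finsupp supp => /andP[/(proj1 dD)[i0 _] /f1_ge].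
exact: leq_trans.
Qed.

Lemma R_attach D r P c y P' s t : attachable D r P c y -> ins D r P r.+1 y P' s t ->
  [/\ Rmap (attach P r c y) = P', r2 (attach P r c y) = s
    & r2' (attach P r c y) = t].
Proof.
move=> A S.
have [V _ sD _ _] := ins_end S; have [dU _ _ _ _] := V.
have sU := fset1U1 (s, t) D; have := diagram_card dU sU.
rewrite cardfsU1 sD => le; have [_ t0] := dU.1 _ _ sU.
rewrite /Rmap /r2 /r2' (attach_R A) (ins_row_insert S) //; lia.
Qed.

Lemma R_ins D r P c y : attachable D r P c y ->
  ins D r P r.+1 y (Rmap (attach P r c y)) (r2 (attach P r c y)) (r2' (attach P r c y)).
Proof.
move=> A; have [H _ _ _ _] := A; have [P' [s [t S]]] := ins_exist H.
by have [-> -> ->] := R_attach A S.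
Qed.

(** * The map from the check side to the hat side *)

Definition has_width (w : nat) (D : {fset nat * nat}) : Prop :=
  forall j, ((1, j) \in D) = (0 < j <= w).

Definition check_cond (P : svtab) (Q : tab) : Prop :=
  f1 Q < r1 P \/ r1 P = f1 Q /\ r2 P <= f2 Q.

Definition hat_cond (P : svtab) (Q : tab) : Prop :=
  r1 P < f1 Q \/ r1 P = f1 Q /\ f2 Q < r2 P.

Lemma Q_col0 D Q i : validQ D Q -> Q (i, 0) = 0.
Proof.
move=> [dD supp _]; apply/eqP; rewrite -[_ == _]negbK supp.
by apply/negP => /(proj1 dD)[].
Qed.

(** When r1(P) = f1(Q), the barrier is the path of F on Q, and s <= f2(Q) makes it reach down to row
    s. *)
Lemma check_guard D P Q s t : validQ D Q -> 0 < r1 P < s ->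
  diagram ((s, t) |` D)%fset -> (s, t) \notin D ->
  f1 Q < r1 P \/ r1 P = f1 Q /\ s <= f2 Q ->
  exists b, [/\ guarded (r1 P) s b Q, strict_below (r1 P) (b (r1 P)) Q
    & b s.-1 < t].
Proof.
move=> V /andP[r0 rs] dU sD.
have [s0 t0] := dU.1 _ _ (fset1U1 (s, t) D).
case=> [lt|[er sf]].
  (* Without equalities from row r1(P) on, column 0 is a barrier, since its value is 0. *)
  exists (fun=> 0); split=> //; last exact: strict_f1_lt V lt.
  by split=> // k _; rewrite (Q_col0 _ V).
rewrite {}er in r0 rs *.
have [T [H le eQ]] := unfill V r0.
set r := f1 Q in r0 rs H le eQ *; set c := f1' Q in H le eQ.
have [Q2 [s2 [t2 S]]] := slides_exist H.
have [_ ef2 _] := F_fill S le; rewrite -eQ in ef2; rewrite ef2 in sf.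
have [b [bmono bc bD g]] := slides_crossing S.
have [dD supp mono] := V.
have rD : (r.+1, c) \in D by case: H => _ /and3P[].
(* The path described by b starts in row r + 1; the first slide of F, out of row r, happens in
   column c. *)
pose b' k := if k <= r then c else b k.
have b'mono : {homo b' : k l / k <= l}.
  move=> k l kl; rewrite /b'; case: (leqP k r) => kr; case: (leqP l r) => lr; try lia.
    by have := bc l; lia.
  exact: bmono.
have b'c k : c <= b' k by rewrite /b'; have := bc k; case: ifP; lia.
have b'D k : r <= k < s -> (k.+1, b' k) \in D.
  rewrite /b' => hk; case: leqP => kr; last by apply: bD; lia.
  by have -> : k = r by lia.
(* The box (s, b'(s - 1)) belongs to the diagram, while (s, t) lies just outside it. *)
have b't : b' s.-1 < t.
  rewrite ltnNge; apply/negP => tb; move/negP: sD; apply.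
  apply: (dD.2 s (b' s.-1)); try lia.
  by have := b'D s.-1; rewrite (@ltn_predK r) //; apply; lia.
exists b'; split=> //.
  split=> // k hk.
  have inD : Q (k, (b' k).+1) != 0.
    rewrite supp; have : (k, (b' k).+1) \in ((s, t) |` D)%fset.
      apply: (dU.2 s t); first exact: fset1U1.
        by lia.
      by have : b' k <= b' s.-1 by [apply: b'mono; lia]; lia.
    by rewrite in_fset1U => /orP[/eqP[]|//]; lia.
  case: (eqVneq k r) => [ek|nk].
    subst k; have er : b' r = c by rewrite /b' leqnn.
    rewrite er in inD *; have := f1P V r0; rewrite eq_belowE => /andP[_ /eqP <-].
    by apply: mono.
  have hk' : r.+1 <= k < s2 by lia.
  have eb : b' k = b k by rewrite /b' ifN //; lia.
  rewrite eb in inD *; have bck := bc k.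
  have e1 : Q (k, (b k).+1) = T (k, (b k).+1) by rewrite eQ fillE ifN //; lia.
  have -> : Q (k.+1, b k) = T (k.+1, b k) by rewrite eQ fillE ifN //; lia.
  by rewrite e1 in inD *; apply: g.
by rewrite /b' leqnn; apply: strict_f1 V.
Qed.

Lemma check_main w D P Q : validP D P -> validQ D Q -> has_width w D ->
  0 < eps P + delta Q -> check_cond P Q ->
  let P' := Rmap P in let Q' := check_phi P Q in
  [/\ exists D', [/\ validP D' P', validQ D' Q' & has_width w D'],
      hat_cond P' Q',
      hat_phi P' Q' = P /\ Fmap Q' = Q,
      mu P =1 mu P' /\ nu Q =1 nu Q'
    & eps P = (eps P').+1 /\ (delta Q).+1 = delta Q'].
Proof.
move=> VP VQ wD pos cond.
have r0 : 0 < r1 P.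
  case: cond => [|[er _]]; first by case: (r1 P).
  move: pos; rewrite addn_gt0 => /orP[/(eps_r1 VP)//|/(delta_f1 VQ)].
  by rewrite er.
have [P0 [y [A eP]]] := detach VP r0.
have := R_ins A; rewrite -eP => S.
set r := r1 P in r0 A eP S; set c := r1' P in A eP.
set s := r2 P in S *; set t := r2' P in S.
have [VP' sb sD dD _] := ins_end S; have [dU _ _ _ _] := VP'.
have rs := ins_le S; have [s0 t0] := dU.1 _ _ (fset1U1 (s, t) D).
have cond' : f1 Q < r1 P \/ r1 P = f1 Q /\ s <= f2 Q by [].
have [|b [g st bt]] := check_guard (s := s) (t := t) VQ _ dU sD cond'.
  by rewrite r0.
rewrite -/r in g st.
have br : b r < t by apply: leq_ltn_trans bt; apply: g.1; lia.
have [|T [j [Sl le brj]]] := slides_back (valid_hole VQ st dU sD _ br) g bt.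
  by rewrite r0.
have H := slides_start Sl.
rewrite (check_phi_fill Sl le) -/r.
have [e1 e1'] := fill_f1 H; have [eF e2 e2'] := F_fill Sl le.
have VQ' := fill_valid H le.
have emu : mu P =1 mu (Rmap P).
  by move=> k; rewrite (ins_mu k S) {1}eP (attach_mu k A).
have enu : nu Q =1 nu (fill T r j) by move=> k; rewrite (fill_nu H) (slides_nu Sl).
have cU : #|` (s, t) |` D|%fset = #|` D|.+1 by rewrite cardfsU1 sD.
split.
- exists ((s, t) |` D)%fset; split=> // k.
  by rewrite in_fset1U wD; case: eqP => // -[]; lia.
- rewrite /hat_cond e1 e2.
  have := single_below_r1_le sb; rewrite leq_eqVlt => /orP[/eqP er|]; last by left.
  right; split=> //.
  have r0' : 0 < r1 (Rmap P) by rewrite er.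
  have [P0' [y' [A' eP']]] := detach VP' r0'.
  have gt1 := r1P VP' r0'.
  set c' := r1' (Rmap P) in A' eP' gt1; rewrite er in A' eP' gt1.
  have S' := R_ins A'; rewrite -eP' in S'.
  have [u [uy _ uP']] := ins_trace S.
  have y'P : y' \in Rmap P (r, c') by rewrite eP' attachE !eqxx fset1U1.
  apply: (@ins_escape _ _ _ _ _ _ _ _ u s S') => [k hk|_].
    have eqr l : P0' (k, l) = Rmap P (k, l) by rewrite eP' attachE ifN //; lia.
    have [c1 [e h]] := uP' k hk; exists c1; rewrite eqr; split=> // ks l a.
    by rewrite eqr; apply: h.
  have agree l : Rmap P (r, l) = P0 (r, l) by apply: (ins_agree _ S).
  rewrite uy; case: A => _ _ lt _ sg.
  (* The second inserted integer y' is below y: a box with several elements cannot lie to the right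
     of c, and up to c all elements are below y. *)
  case: (leqP c' c) => cc; first by apply: (lt _ _ cc); rewrite -agree.
  by have := sg _ cc; rewrite -agree leqNgt gt1.
- split=> //; rewrite [RHS]eP.
  have eH := @hat_phi_attach D (Rmap P) (fill T r j) c P0 y.
  rewrite e1 e2 e2' in eH; apply: eH => //.
    by case: A.
  by case: A => _ _ lt ge _; split.
- by [].
- by split; [have := eps_mu VP VP' emu|have := delta_card VQ VQ' enu]; rewrite cU; lia.
Qed.

(** * The map from the hat side to the check side *)

Lemma hat_guard D P s : validP D P -> 0 < r1 P -> s < r2 P -> exists u : nat -> nat,
  [/\ forall k, r1 P < k <= s ->
        u k < u k.+1 /\ exists c, P (k, c) = [fset u k.+1]%fset
    & forall j a, j <= r1' P -> a \in P (r1 P, j) -> a <= u (r1 P).+1].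
Proof.
move=> V r0 sr; have [P0 [y [A eP]]] := detach V r0.
have := R_ins A; rewrite -eP => S.
have [u [uy uP _]] := ins_trace S; exists u; split=> [k hk|j a jc].
  have [|lt [c e]] := uP k; first lia.
  by split=> //; exists c; rewrite eP attachE ifN //; lia.
rewrite uy {1}eP attachE eqxx /=; case: A => _ _ lt _ _.
case: eqP => [_ /fset1UP[->//|aP]|_ aP]; apply: ltnW.
  exact: lt aP.
exact: lt aP.
Qed.

(** Take for c the last column whose set lies below y. Sets with several elements all lie below y,
    so only single entries remain to the right of c, and y cuts no set in two. *)
Lemma attach_col D r P y : pending D r P r.+1 y ->
  (forall j a, 1 < #|` P (r, j)| -> a \in P (r, j) -> a < y) ->
  exists c, attachable D r P c y.
Proof.
move=> H gt; have [V /andP[r0 _] sb [p /= [pD ltp _]]] := H.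
have [dD supp pos col row] := V; have [Dpos Dle] := dD.
pose below j := ((r, j) \in D) && all (fun a => a < y) (P (r, j)).
have ex : exists j, below j.
  by exists p; rewrite /below pD; apply/allP => a; apply: ltp.
have ub j : below j -> j <= #|` D|.+1.
  by move=> /andP[/(diagram_card dD)]; lia.
case: (ex_maxnP ex ub) => c /andP[cD /allP ltc] max_c.
have lt j a : j <= c -> a \in P (r, j) -> a < y.
  rewrite leq_eqVlt => /orP[/eqP ->|jc aP]; first exact: ltc.
  have [a' a'P] := valid_ex V cD.
  by apply: leq_ltn_trans (ltc _ a'P); apply: row aP a'P jc.
have sg j : c < j -> #|` P (r, j)| <= 1.
  move=> cj; rewrite leqNgt; apply/negP => gt1.
  have [a aP] : exists a, a \in P (r, j).
    by apply/fset0Pn; rewrite -cardfs_gt0; apply: leq_trans gt1.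
  suff /max_c : below j by lia.
  by rewrite /below (valid_mem V aP); apply/allP => a'; apply: gt gt1.
exists c; split=> // j a cj aP; rewrite leqNgt; apply/negP => ay.
suff /max_c : below j by lia.
rewrite /below (valid_mem V aP) (fset1_card (sg _ cj) aP).
by apply/allP => a' /fset1P ->.
Qed.

(** A removed corner is read as an insertion path without bumps, which [ins_back] then extends
    upwards. *)
Lemma remove_ins D r P s t : validP D P -> single_below r P -> 0 < r < s ->
  (s, t) \in D -> diagram (D `\ (s, t))%fset ->
  ins (D `\ (s, t))%fset r [fsfun P with (s, t) |-> fset0] s (fsmax (P (s, t))) P s t.
Proof.
move=> V sb rs sD dD1; have H := pending_remove V sb rs sD dD1.
have [dD _ _ _ row] := V; have [z zP] := valid_ex V sD.
have e : P (s, t) = [fset z]%fset by apply: fset1_card zP; apply: sb; lia.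
have ez : fsmax (P (s, t)) = z by rewrite e fsmax1.
rewrite ez in H *.
suff {2}-> : P = [fsfun [fsfun P with (s, t) |-> fset0] with (s, t) |-> [fset z]%fset].
  apply: ins_new => //; first by rewrite in_fsetD1 eqxx.
    by rewrite fsetD1K.
  by move=> j a jt; rewrite with_other; [move=> aP; apply: row aP zP jt|lia].
apply/fsfunP => -[k l]; rewrite !withE -e.
by case: ifP => [/andP[/eqP -> /eqP ->]|-> //].
Qed.

Lemma hat_main w D P Q : validP D P -> validQ D Q -> has_width w D ->
  0 < eps P + delta Q -> hat_cond P Q ->
  let P' := hat_phi P Q in let Q' := Fmap Q in
  [/\ exists D', [/\ validP D' P', validQ D' Q' & has_width w D'],
      check_cond P' Q',
      Rmap P' = P /\ check_phi P' Q' = Q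
    & 0 < eps P'].
Proof.
move=> VP VQ wD pos cond.
have f0 : 0 < f1 Q.
  case: cond => [|[er _]]; first by case: (f1 Q).
  move: pos; rewrite addn_gt0 => /orP[/(eps_r1 VP)|/(delta_f1 VQ)//].
  by rewrite er.
have [T [H le eQ]] := unfill VQ f0.
have [Q1 [s [t Sl]]] := slides_exist H.
have [eF e2 e2'] := F_fill Sl le; rewrite -eQ in eF e2 e2'.
rewrite /hat_cond e2 in cond.
set r := f1 Q in f0 cond H le eQ Sl; set c := f1' Q in H le eQ Sl.
have [VQ1 st1 sD] := slides_valid Sl.
have [dD1 supp1 _] := VQ1.
have [rs ct] := slides_le Sl.
have rP : r1 P <= r by case: cond => [/ltnW|[->]].
have rs0 : 0 < r < s by rewrite f0.
have S1 := remove_ins VP (single_below_r1 rP) rs0 sD dD1.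
set P1 := [fsfun P with (s, t) |-> fset0] in S1.
(* The function u traces the insertion of R on P, which passes below row s if r1(P) = r. If r1(P) <
   r, nothing is asked of u and [id] will do. *)
have [u [ug ur]] : exists u : nat -> nat,
  [/\ r1 P = r -> forall k, r < k <= s ->
        u k < u k.+1 /\ exists l, P (k, l) = [fset u k.+1]%fset
    & r1 P = r -> forall j a, j <= r1' P -> a \in P (r, j) -> a <= u r.+1].
  case: cond => [lt|[er sr]]; first by exists id; split; lia.
  have [|u [g1 g2]] := hat_guard VP _ sr; first by rewrite er.
  by exists u; rewrite er in g1 g2; split.
have [dD suppP posP colP rowP] := VP; have [Dpos Dle] := dD.
have tmax l : (s, l) \in D -> l <= t.
  move=> lD; rewrite leqNgt; apply/negP => tl.
  suff : (s, t) \in (D `\ (s, t))%fset by rewrite in_fsetD1 eqxx.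
  apply: (dD1.2 s l); rewrite ?in_fsetD1 ?lD ?andbT.
  - by apply/eqP => -[]; lia.
  - by have := Dpos _ _ sD; lia.
  - by have := Dpos _ _ sD; lia.
have [||P0 [y [S0 uy]]] := @ins_back _ _ _ _ _ _ _ _ (r1 P = r) u S1.
- move=> er k hk; have [|lt [l e]] := ug er k; first lia.
  by split=> //; exists l; rewrite /P1 with_other //; lia.
(* The integer u(s + 1) lies in row s, whose last box is (s, t), so it is at most the removed
   entry. *)
- move=> er; have [|lt [l e]] := ug er s; first lia.
  have uP : u s.+1 \in P (s, l) by rewrite e inE.
  apply: leq_trans lt _.
  have [z zP] := valid_ex VP sD.
  have ez : P (s, t) = [fset z]%fset.
    by apply: fset1_card zP; apply: (single_below_r1 rP); lia.
  rewrite ez fsmax1; have := tmax _ (valid_mem VP uP).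
  rewrite leq_eqVlt => /orP[/eqP el|lt']; last exact: rowP uP zP lt'.
  by move: uP; rewrite el ez => /fset1P ->.
have agree j : P0 (r, j) = P (r, j) by rewrite -(ins_agree _ S0).
(* A set with several elements in row r forces r1(P) = r, and then its elements are at most u(r + 1)
   < y. *)
have [c' A] : exists c', attachable (D `\ (s, t))%fset r P0 c' y.
  apply: attach_col (ins_pending S0) _ => j a; rewrite agree => gt1 aP.
  have er : r1 P = r by apply/eqP; rewrite eqn_leq rP (r1_ge gt1).
  apply: leq_ltn_trans (uy er); apply: (ur er _ _ _ aP).
  by apply: r1'_ge; rewrite er.
have eH : hat_phi P Q = attach P0 r c' y.
  apply: (@hat_phi_attach (D `\ (s, t))%fset); rewrite -/r ?e2 ?e2' //.
    by case: A.
  by case: A => _ _ lt ge _; split.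
have [er1 er1'] := attach_r1 A; have [eR es et] := R_attach A S0.
have VP1 := attach_valid A.
rewrite /= eH eF; split.
- exists (D `\ (s, t))%fset; split=> // k.
  by rewrite in_fsetD1 wD; case: eqP => // -[]; lia.
- rewrite /check_cond er1 es.
  have [le1 le2] := strict_f1_le VQ1 st1.
  move: le1; rewrite leq_eqVlt => /orP[/eqP er|]; last by left.
  right; split=> //.
  have f01 : 0 < f1 Q1 by rewrite er.
  have [T1 [H1 le1 eQ1]] := unfill VQ1 f01.
  have [Q2 [s2 [t2 S2]]] := slides_exist H1.
  have [_ ef2 _] := F_fill S2 le1; rewrite -eQ1 in ef2; rewrite ef2.
  have c1c := le2 er; rewrite er in H1 eQ1 S2; set c1 := f1' Q1 in H1 eQ1 S2 c1c.
  have [_ c0 _] := hole_above H.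
  have [b [bmono bc bD g]] := slides_guard Sl.
  (* The second path of F starts in a column at most c - 1, weakly left of the barrier left by the
     first one, so it ends in row s or below. *)
  apply: (slides_escape S2 bmono) => [k hk b0|k hk|_].
  + apply: (hole_in H1); last by apply/pair_neq; lia.
    rewrite in_fsetD1; apply/andP; split.
      by apply/eqP => -[]; have := bc k; lia.
    by apply: (Dle _ _ _ _ (bD k hk)); lia.
  + have bk := bc k; have := g k hk; rewrite eQ1 !fillE !ifN //; lia.
  + by have := bc r.+1; lia.
- split=> //; rewrite [RHS]eQ.
  have := @check_phi_fill D c.-1 (attach P0 r c' y) T c Q1.
  by rewrite er1 es et; apply.
- have emu : mu (attach P0 r c' y) =1 mu P.
    by move=> k; rewrite (attach_mu k A) (ins_mu k S0).
  have := eps_mu VP1 VP emu; rewrite (cardfsD1 (s, t) D) sD; lia.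
Qed.

(** * Young diagrams as partitions *)

Lemma boxesE lam i j : boxes lam (i, j) = (0 < i) && (0 < j <= part lam i).
Proof. by []. Qed.

Lemma boxes_diagram lam (D : {fset nat * nat}) : is_part lam -> D =i boxes lam ->
  diagram D.
Proof.
move=> /andP[srt _] eD.
have DE i j : ((i, j) \in D) = (0 < i) && (0 < j <= part lam i) by rewrite eD.
have anti i i' : 0 < i' <= i -> part lam i <= part lam i'.
  move=> hi; rewrite /part; case: (ltnP i.-1 (size lam)) => h; last first.
    by rewrite [leqLHS]nth_default.
  apply: (sorted_leq_nth (leT := geq) _ _ 0 srt); rewrite ?inE; try lia.
  - by move=> x y z /= h1 h2; apply: leq_trans h2 h1.
  - exact: leqnn.
split=> [i j|i j i' j']; rewrite !DE; first lia.
by move=> h hi hj; have := anti _ _ hi; lia.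
Qed.

Lemma diagram_part (D : {fset nat * nat}) : diagram D -> exists lam,
  is_part lam /\ D =i boxes lam.
Proof.
move=> dD; have [Dpos Dle] := dD.
have [m Dm] : exists m, forall i, ((i, 1) \in D) = (0 < i <= m).
  have ub i : (i, 1) \in D -> i <= #|` D|.+1 by move=> /(diagram_card dD); lia.
  case: (boolP ((1, 1) \in D)) => [D1|nD1].
    have ex : exists i, (i, 1) \in D by exists 1.
    case: (ex_maxnP ex ub) => m mD le; exists m => i.
    apply/idP/idP => [iD|h]; first by rewrite le // andbT; case: (Dpos _ _ iD).
    by apply: (Dle _ _ _ _ mD).
  exists 0 => i; apply/idP/idP => [iD|]; last lia.
  case/negP: nD1; have [? ?] := Dpos _ _ iD.
  by apply: (Dle _ _ _ _ iD); lia.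
have pos i : (0 < rowlen D i) = (0 < i <= m).
  by rewrite -Dm (rowlenP _ _ dD).
exists (map (rowlen D) (iota 1 m)); split.
  apply/andP; split; last first.
    by apply/mapP => -[i]; rewrite mem_iota => hi e; have := pos i; rewrite -e; lia.
  apply/(sortedP 0) => i; rewrite size_map size_iota => im.
  rewrite !(nth_map 0) ?size_iota ?nth_iota ?add1n; try lia.
  rewrite /= leqNgt; apply/negP => lt.
  have : (i.+2, rowlen D i.+2) \in D by rewrite rowlenP // leqnn; lia.
  move=> /Dle h; have : (i.+1, rowlen D i.+2) \in D by apply: h; lia.
  by rewrite rowlenP //; lia.
move=> [i j]; rewrite [RHS]boxesE rowlenP // /part.
case: (posnP i) => [->|i0] /=.
  by have := pos 0; lia.
case: (leqP i m) => im.
  rewrite (nth_map 0) ?size_iota ?nth_iota; try lia.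
  by have -> : 1 + i.-1 = i by lia.
by rewrite nth_default ?size_map ?size_iota; have := pos i; lia.
Qed.

Lemma fsmin_le (A : {fset nat}) k : k \in A -> fsmin A <= k.
Proof.
move=> kA; rewrite /fsmin; move: (fsmax A) => m.
have {kA} : k \in enum_fset A by [].
elim: (enum_fset A) => // a s IH; rewrite big_cons inE geq_min => /orP[/eqP ->|/IH ->].
  by rewrite leqnn.
by rewrite orbT.
Qed.

Lemma fsmin_in (A : {fset nat}) : A != fset0 -> fsmin A \in A.
Proof.
move=> /fsmax_in; rewrite /fsmin; move: (fsmax A) => m mA.
have : \big[minn/m]_(k <- A) k \in m :: enum_fset A.
  elim: (enum_fset A) => [|a s IH]; first by rewrite big_nil inE.
  rewrite big_cons /minn; case: ifP => _; first by rewrite !inE eqxx orbT.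
  by move: IH; rewrite !inE => /orP[->|->]; rewrite ?orbT.
by rewrite inE => /orP[/eqP ->|].
Qed.

Lemma calPP lam P : is_part lam ->
  (calP lam P <-> validP (finsupp P) P /\ finsupp P =i boxes lam).
Proof.
move=> lamP; split=> [[supp pos col row]|[[dD _ pos col row] supp]].
  have inB b a : a \in P b -> boxes lam b.
    move=> aP; suff : b \in boxes lam by [].
    by rewrite -supp mem_finsupp; apply/fset0Pn; exists a.
  split=> //; split=> //.
  - exact: boxes_diagram supp.
  - by move=> b; rewrite mem_finsupp.
  - move=> i i' j a a' aP a'P ii.
    have := col _ _ _ (inB _ _ aP) (inB _ _ a'P) ii.
    by move=> h; apply: leq_ltn_trans (fsmax_ge aP) (leq_trans h (fsmin_le a'P)).
  - move=> i j j' a a' aP a'P jj.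
    have := row _ _ _ (inB _ _ aP) (inB _ _ a'P) jj.
    by move=> h; apply: leq_trans (fsmax_ge aP) (leq_trans h (fsmin_le a'P)).
have n0 b : boxes lam b -> P b != fset0.
  by move=> bB; rewrite -mem_finsupp supp.
split=> //.
- move=> i i' j /n0 h /n0 h' ii.
  exact: col _ _ _ _ _ (fsmax_in h) (fsmin_in h') ii.
- move=> i j j' /n0 h /n0 h' jj.
  exact: row _ _ _ _ _ (fsmax_in h) (fsmin_in h') jj.
Qed.

Lemma calQP lam Q : is_part lam ->
  (calQ lam Q <-> validQ (finsupp Q) Q /\ finsupp Q =i boxes lam).
Proof.
move=> lamP; split=> [[supp row col]|[[dD _ mono] supp]].
  have dD := boxes_diagram lamP supp.
  split=> //; split=> // [b|i j i' j' ii jj n]; first by rewrite mem_finsupp.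
  case: (eqVneq (Q (i, j)) 0) => [->//|n'].
  have inB b : Q b != 0 -> boxes lam b.
    by move=> nb; suff : b \in boxes lam by []; rewrite -supp mem_finsupp.
  have iD : (i, j) \in finsupp Q by rewrite mem_finsupp.
  have i'D : (i', j') \in finsupp Q by rewrite mem_finsupp.
  (* The row and column conditions are combined through the intermediate box (i, j'). *)
  have mD : (i, j') \in finsupp Q.
    by apply: (dD.2 _ _ _ _ i'D); have := dD.1 _ _ iD; have := dD.1 _ _ i'D; lia.
  have nm : Q (i, j') != 0 by rewrite -mem_finsupp.
  apply: (@leq_trans (Q (i, j'))).
    move: jj; rewrite leq_eqVlt => /orP[/eqP -> //|jj].
    by apply: row => //; apply: inB.
  move: ii; rewrite leq_eqVlt => /orP[/eqP -> //|ii].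
  by apply: col => //; apply: inB.
have n0 b : boxes lam b -> Q b != 0.
  by move=> bB; rewrite -mem_finsupp supp.
split=> //.
- by move=> i j j' /n0 h /n0 h' jj; apply: mono => //; apply: ltnW.
- by move=> i i' j /n0 h /n0 h' jj; apply: mono => //; apply: ltnW.
Qed.

(** Both maps change the shape by a box below the first row, so of the partition only the width has
    to be remembered. *)
Definition shared_shape (w : nat) (P : svtab) (Q : tab) : Prop :=
  exists D, [/\ validP D P, validQ D Q & has_width w D].

Lemma shared_shapeP w P Q : shared_shape w P Q <->
  exists lam, [/\ is_part lam, part lam 1 = w, calP lam P & calQ lam Q].
Proof.
split=> [[D [VP VQ wD]]|
    [lam [lamP <- /(calPP _ lamP)[VP suppP] /(calQP _ lamP)[VQ suppQ]]]].
  have eP := valid_finsupp VP.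
  have eQ : finsupp Q = D by apply/fsetP => b; case: VQ => _ <- _; rewrite mem_finsupp.
  have [lam [lamP eD]] : exists lam, is_part lam /\ D =i boxes lam.
    by apply: diagram_part; case: VP.
  exists lam; split=> //.
  - have h j : (0 < j <= part lam 1) = (0 < j <= w) by rewrite -wD eD.
    by have := h w; have := h (part lam 1); lia.
  - by apply/calPP => //; rewrite eP.
  - by apply/calQP => //; rewrite eQ.
exists (finsupp P); split=> //.
  suff -> : finsupp P = finsupp Q by [].
  by apply/fsetP => b; rewrite suppP suppQ.
Qed.

Lemma calR_check_widthP w P Q : calR_check_width w (P, Q) <->
  [/\ shared_shape w P Q, 0 < eps P + delta Q & check_cond P Q].
Proof.
split=> [[lam [lamP wl] [[[cP cQ] pos] cond]]|
    [/shared_shapeP[lam [lamP wl cP cQ]] pos cond]].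
  by split=> //; apply/shared_shapeP; exists lam.
by exists lam.
Qed.

Lemma calR_hat_widthP w P Q : calR_hat_width w (P, Q) <->
  [/\ shared_shape w P Q, 0 < eps P + delta Q & hat_cond P Q].
Proof.
split=> [[lam [lamP wl] [[[cP cQ] pos] cond]]|
    [/shared_shapeP[lam [lamP wl cP cQ]] pos cond]].
  by split=> //; apply/shared_shapeP; exists lam.
by exists lam.
Qed.

Theorem theorem4p1 (w : nat) :
  [/\ set_bij (calR_check_width w) (calR_hat_width w) check_Phi,
      (forall (P : svtab) (Q : tab), calR_check_width w (P, Q) ->
        forall (P' : svtab) (Q' : tab), check_Phi (P, Q) = (P', Q') ->
        [/\ mu P =1 mu P', nu Q =1 nu Q',
            eps P = (eps P').+1 & (delta Q).+1 = delta Q'])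
    & [/\ set_fun (calR_hat_width w) (calR_check_width w) hat_Phi,
          {in calR_check_width w, cancel check_Phi hat_Phi}
        & {in calR_hat_width w, cancel hat_Phi check_Phi}]].
Proof.
have check_fun : set_fun (calR_check_width w) (calR_hat_width w) check_Phi.
  move=> [P Q] /calR_check_widthP[[D [VP VQ wD]] pos cond].
  have [sh cond' _ _ [_ ed]] := check_main VP VQ wD pos cond.
  by apply/calR_hat_widthP; split=> //; rewrite -ed addnS.
have hat_fun : set_fun (calR_hat_width w) (calR_check_width w) hat_Phi.
  move=> [P Q] /calR_hat_widthP[[D [VP VQ wD]] pos cond].
  have [sh cond' _ pos'] := hat_main VP VQ wD pos cond.
  by apply/calR_check_widthP; split=> //; rewrite addn_gt0 pos'.
have checkK : {in calR_check_width w, cancel check_Phi hat_Phi}.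
  move=> [P Q]; rewrite in_setE => /calR_check_widthP[[D [VP VQ wD]] pos cond].
  have [_ _ [eP eQ] _ _] := check_main VP VQ wD pos cond.
  by rewrite /hat_Phi /= eP eQ.
have hatK : {in calR_hat_width w, cancel hat_Phi check_Phi}.
  move=> [P Q]; rewrite in_setE => /calR_hat_widthP[[D [VP VQ wD]] pos cond].
  have [_ _ [eP eQ] _] := hat_main VP VQ wD pos cond.
  by rewrite /check_Phi /= eP eQ.
split=> //; last first.
  move=> P Q /calR_check_widthP[[D [VP VQ wD]] pos cond] P' Q' [<- <-].
  by have [_ _ _ [? ?] [? ?]] := check_main VP VQ wD pos cond.
split=> //; first exact: can_in_inj checkK.
move=> PQ hPQ; exists (hat_Phi PQ); first exact: hat_fun.
by apply: hatK; rewrite in_setE.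
Qed.
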